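(* Let $P$ be a natural unit interval order on $[n]$ and let $G$ be its incomparability graph. Then $$X_G(\mathbf x,t)=\sum_{T\in\mathcal T_P}t^{\mathrm{inv}_G(T)}s_{\lambda(T)}.$$
   Context: A natural unit interval order is a poset $P$ on $[n]$ such that (1) $x<_P y$ implies $x<y$ as integers, and (2) whenever the disjoint union of a chain $x<_P z$ and an element $y$ (incomparable to both) is an induced subposet of $P$, then $x<y<z$ as integers. The incomparability graph $G$ has vertex set $[n]$ and edges the $P$-incomparable pairs. For a graph $G$ on $[n]$: proper colorings $c:[n]\to\mathbb P$ ($c(i)\ne c(j)$ for $\{i,j\}\in E(G)$), $\mathbf x_c=\prod_i x_{c(i)}$, $\mathrm{asc}(c)=|\{\{i,j\}\in E(G):i<j,\ c(i)<c(j)\}|$, $X_G(\mathbf x,t)=\sum_c t^{\mathrm{asc}(c)}\mathbf x_c$. A $P$-tableau of shape $\lambda\vdash n$ is a filling of the Young diagram of $\lambda$ (English notation) with the elements of $P$, each appearing exactly once, such that if $y$ is immediately right of $x$ then $y>_P x$, and if $y$ is immediately below $x$ then $y\not<_P x$. $\mathcal T_P$ is the set of all $P$-tableaux, $\lambda(T)$ the shape of $T$, and $\mathrm{inv}_G(T)$ is the number of edges $\{i,j\}\in E(G)$ with $i<j$ such that $i$ appears in a row strictly below the row of $j$ in $T$. $s_\lambda$ is the Schur function. *)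

(* Defs.v *)
From mathcomp Require Import all_boot all_order all_algebra.
From mathcomp Require Import finmap.
From mathcomp.multinomials Require Import monalg.
From mathcomp Require Import boolp classical_sets functions cardinality fsbigop.

Set Implicit Arguments.
Unset Strict Implicit.
Unset Printing Implicit Defensive.

Import GRing.Theory.
Local Open Scope classical_set_scope.
Local Open Scope ring_scope.

(* Formal power series over Z[t] in the variables x_0, x_1, x_2, ... (the
   positive integers shifted by one), given by their coefficients on monomials.
   The regular module {poly int}^o makes them a Z[t]-module under the pointwise
   operations; t is the polynomial variable 'X. *)
Definition series := {cmonom nat} -> {poly int}^o.

(* The series \sum_(a in D) f a * x^(wt a).  Every use below has finite fibres
   D `&` wt @^-1` [set m] (see the finiteness lemmas), so that the
   finite-support sum is the actual sum. *)
Definition genseries (A : choiceType) (D : set A) (f : A -> {poly int})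
    (wt : A -> {cmonom nat}) : series :=
  fun m => \sum_(a \in D `&` wt @^-1` [set m]) f a.

Section Orders.
Variable n : nat.
Implicit Types (P G : rel 'I_n) (c : {ffun 'I_n -> nat}).

Definition incomp P : rel 'I_n :=
  fun x y => [&& x != y, ~~ P x y & ~~ P y x].

(* P is the strict order relation <_P, on {0, ..., n-1} in place of [n]. *)
Record natural_unit_interval_order P : Prop := NaturalUnitIntervalOrder {
  nuio_irr : irreflexive P;
  nuio_trans : transitive P;
  nuio_natural : forall x y, P x y -> (x < y)%N;
  nuio_unit : forall x y z, P x z -> incomp P y x -> incomp P y z ->
    (x < y)%N /\ (y < z)%N
}.

Definition proper_coloring G c : Prop :=
  forall i j, G i j -> c i <> c j.

Definition asc G c : nat :=
  #|[set p : 'I_n * 'I_n | [&& G p.1 p.2, (p.1 < p.2)%N & (c p.1 < c p.2)%N]]%SET|.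

Definition coloring_monom c : {cmonom nat} :=
  \big[mmul/mone]_(i < n) ucm (c i).

Definition chromatic_series G : series :=
  genseries [set c | proper_coloring G c] (fun c => 'X^(asc G c)) coloring_monom.

End Orders.

(* Fillings of left-justified diagrams, given as lists of rows from top to
   bottom (English notation). *)
Section Fillings.
Variable A : Type.
Implicit Types (T : seq (seq A)).

Definition entry T (i j : nat) : option A := onth (nth [::] T i) j.

Definition is_partition (la : seq nat) : bool :=
  sorted geq la && (0%N \notin la).

Record is_tableau (right_of below : A -> A -> bool) T : Prop := IsTableau {
  tab_shape : is_partition (shape T);
  tab_row : forall i j x y,
    entry T i j = Some x -> entry T i j.+1 = Some y -> right_of x y;
  tab_col : forall i j x y,
    entry T i j = Some x -> entry T i.+1 j = Some y -> below x y
}.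

End Fillings.

Definition ssyt (T : seq (seq nat)) : Prop := is_tableau leq ltn T.

Definition tableau_monom (T : seq (seq nat)) : {cmonom nat} :=
  \big[mmul/mone]_(k <- flatten T) ucm k.

Definition schur (la : seq nat) : series :=
  genseries [set T | ssyt T /\ shape T = la] (fun=> 1) tableau_monom.

Section PTableaux.
Variable n : nat.
Implicit Types (P G : rel 'I_n) (T : seq (seq 'I_n)).

Definition P_tableaux P : set (seq (seq 'I_n)) :=
  [set T | is_tableau (fun x y => P x y) (fun x y => ~~ P y x) T
           /\ perm_eq (flatten T) (enum 'I_n)].

Definition row_index T (x : 'I_n) : nat := find (fun r => x \in r) T.

Definition tab_inv G T : nat :=
  #|[set p : 'I_n * 'I_n |
      [&& G p.1 p.2, (p.1 < p.2)%N & (row_index T p.2 < row_index T p.1)%N]]%SET|.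

End PTableaux.

Lemma mem_prod_ucm (s : seq nat) (k : nat) :
  (k \in s) = (k \in finsupp (\big[mmul/mone]_(i <- s) ucm i : {cmonom nat})).
Proof.
elim: s => [|a s IH]; first by rewrite big_nil mdom1 !inE.
by rewrite big_cons mdomD !inE IH mdomU inE.
Qed.

Lemma finite_coloring_fibre n (m : {cmonom nat}) :
  finite_set (@coloring_monom n @^-1` [set m]).
Proof.
pose g (d : {ffun 'I_n -> finsupp m}) := [ffun i => val (d i)] : {ffun 'I_n -> nat}.
apply: (@sub_finite_set _ _ (range g)); last exact/finite_image/finite_finset.
move=> c /= cm.
have cP i : c i \in finsupp m.
  have -> : m = \big[mmul/mone]_(k <- [seq c i | i <- enum 'I_n]) ucm k.
    by rewrite big_map -cm /coloring_monom big_enum.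
  by rewrite -mem_prod_ucm map_f ?mem_enum.
exists [ffun i => [` cP i]%fset] => //; apply/ffunP => i; by rewrite !ffunE.
Qed.

Lemma finite_tableau_fibre la (m : {cmonom nat}) :
  finite_set ([set T | ssyt T /\ shape T = la] `&` tableau_monom @^-1` [set m]).
Proof.
pose g (d : (sumn la).-tuple (finsupp m)) := reshape la [seq val i | i <- d].
apply: (@sub_finite_set _ _ (range g)); last exact/finite_image/finite_finset.
move=> T /= [[_ Tla] Tm].
have FP : all [in finsupp m] (flatten T).
  by apply/allP => k; rewrite -Tm -mem_prod_ucm.
have /eqP sF : size (pmap (insub : nat -> option (finsupp m)) (flatten T)) = sumn la.
  by rewrite size_pmap_sub -Tla -size_flatten; apply/eqP; rewrite -all_count.
exists (Tuple sF) => //; rewrite /g /=.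
have -> : [seq val i | i <- pmap (insub : nat -> option (finsupp m)) (flatten T)]
  = flatten T.
  by rewrite pmap_filter ?(all_filterP _) //; [apply: sub_all FP => k kP;
    rewrite /= insubT | exact: insubK].
by rewrite -Tla flattenK.
Qed.

Lemma finite_P_tableaux n (P : rel 'I_n) : finite_set (P_tableaux P).
Proof.
pose g (d : n.-bseq 'I_n.+1 * n.-tuple 'I_n) :=
  reshape [seq val i | i <- d.1] d.2.
apply: (@sub_finite_set _ _ (range g)); last exact/finite_image/finite_finset.
move=> T /= [[/andP[_ s0] _ _] pT].
have sT : sumn (shape T) = n by rewrite -size_flatten (perm_size pT) size_enum_ord.
have szF : size (flatten T) == n by rewrite size_flatten sT.
have szS : (size (shape T) <= n)%N.
  rewrite -{2}sT; elim: (shape T) s0 => //= a s IH.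
  rewrite inE negb_or => /andP[a0 /IH sz]; rewrite -[X in (X <= _)%N]add1n.
  by rewrite leq_add // lt0n eq_sym.
have bS : {in shape T, forall k, (k < n.+1)%N}.
  move=> k; rewrite -[X in (_ < X.+1)%N]sT; elim: (shape T) => //= a s IH; rewrite inE ltnS.
  case/orP=> [/eqP->|/IH]; first exact: leq_addr.
  by rewrite ltnS => /leq_trans; apply; exact: leq_addl.
have szB : (size (map (inord : nat -> 'I_n.+1) (shape T)) <= n)%N by rewrite size_map.
exists (Bseq szB, Tuple szF) => //; rewrite /g /= -map_comp.
rewrite (_ : map _ _ = shape T) ?flattenK //.
by rewrite -[RHS]map_id; apply/eq_in_map => k kT /=; rewrite inordK // bS.
Qed.

(* Main.v *)
Require Import Defs.
From mathcomp Require Import all_boot all_order all_algebra all_fingroup.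
From mathcomp Require Import zify finmap.
From mathcomp.multinomials Require Import monalg.
From mathcomp Require Import boolp classical_sets functions cardinality fsbigop.

Set Implicit Arguments.
Unset Strict Implicit.
Unset Printing Implicit Defensive.

Import GRing.Theory.

(** Let [V] be the Vandermonde determinant in [k >= n] variables and write [alt la] for the
    alternant [det (x_i ^ (la_l + k - 1 - l))].  Row operations on the determinant give
    [alt la = V * s_la] by induction on [k], the multilinear expansion being indexed by the
    partitions interlacing [la].

    For a natural unit interval order, the vertices of two consecutive colours [r], [r + 1]
    span a disjoint union of paths with alternating colours.  Exchanging the colours on the
    paths having unequal numbers of the two colours preserves the number of descending edges,
    hence the chromatic polynomial is symmetric, and [V * X] is the sum over proper colourings
    [c] of [t ^ des c * alt (sizes of the colour classes of c)].  Gasharov's tail exchange,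
    again restricted to these unbalanced paths, swaps two rows of the alternant, so the
    colourings whose array of colour classes violates the column condition cancel.  The other
    colourings are the P-tableaux, and [V] is cancelled at the end. *)

(** * Alternants and semistandard tableaux *)

(** The obstacle is the statistic. Exchanging the colours of a whole tail is enough at [t = 1], but
    it may change the number of descents. An alternating path with equally many vertices of both
    colours has an odd number of edges, so exchanging its colours would shift the descents by one;
    since it contributes equally to both classes, leaving it alone does not disturb the class sizes.
    A path with unequal numbers may be exchanged for free. The two colours have to be consecutive so
    that any third colour compares in the same way with both. Descents replace the ascents of the
    statement because a tableau, read as the colouring by row index, has its inversions as descents.
    Reversing the colours leads back to ascents and is allowed by symmetry. All identities live in
    finitely many variables: [k] is at least [n], so that every tableau fits into [k] rows, and
    exceeds the index of every variable of the monomial whose coefficient is compared. *)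

Lemma nth_ffun_enum k N (f : {ffun 'I_k -> 'I_N}) (l : 'I_k) :
  nth 0 [seq val (f i) | i <- enum 'I_k] l = f l.
Proof. by rewrite (nth_map l) ?size_enum_ord // nth_ord_enum. Qed.

Section Alternants.
Variable R : comNzRingType.
Variable x : nat -> R.
Local Open Scope ring_scope.

(** The exponents are [la] plus the staircase [(k-1, ..., 1, 0)]. Since [la] is an arbitrary
    function, unsorted sequences of class sizes are allowed. *)
Definition alternant k (la : nat -> nat) : R :=
  \det (\matrix_(l < k, i < k) x i ^+ (la l + (k.-1 - l))).

Definition vandermonde k : R := \prod_(j < k) \prod_(i < j) (x i - x j).

Lemma det_sum_rows k N (a : 'I_k -> 'I_k -> 'I_N -> R) :
  \det (\matrix_(l, i) \sum_p a l i p) =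
  \sum_(f : {ffun 'I_k -> 'I_N}) \det (\matrix_(l, i) a l i (f l)).
Proof.
rewrite /determinant exchange_big /=; apply: eq_bigr => s _.
rewrite -mulr_sumr; congr (_ * _).
under eq_bigr do rewrite mxE.
rewrite bigA_distr_bigA; apply: eq_bigr => f _.
by apply: eq_bigr => l _; rewrite mxE.
Qed.

(** This is the branching rule in the last variable: the power of [x k] is the weight of the
    horizontal strip between [f] and [la], and the product of differences is the last layer of the
    Vandermonde product. The bound [N] makes the range of the parts a finite type for the
    multilinear expansion. *)
Lemma alternant_rec k N (la : nat -> nat) :
    (forall l, l < k -> la l.+1 <= la l)%N -> (forall l, la l < N)%N ->
  alternant k.+1 la = (\prod_(i < k) (x i - x k)) *
    \sum_(f : {ffun 'I_k -> 'I_N} | [forall l : 'I_k, la l.+1 <= f l <= la l]%N)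
      x k ^+ la k * (\prod_(l < k) x k ^+ (la l - f l)%N) *
      alternant k (fun l => nth 0 [seq val (f i) | i <- enum 'I_k] l)%N.
Proof.
move=> la_dec la_N.
pose b l := (la l + (k - l))%N.
have b_dec l : (l < k)%N -> (b l.+1 < b l)%N.
  by move=> lk; rewrite /b -addnS -subSn // subSS leq_add // la_dec.
pose M := \matrix_(l < k.+1, i < k.+1) x i ^+ b l.
(* [U] subtracts from each row [l < k] the multiple of row [l + 1] that kills its entry in column
   [k]; only the bottom row survives in that column. *)
pose U := \matrix_(l < k.+1, l' < k.+1)
  ((l == l')%:R - ((l' == l.+1 :> nat)%:R * x k ^+ (b l - b l.+1)%N)).
have detU : \det U = 1.
  rewrite -det_tr det_trig.
    by rewrite big1 // => i _; rewrite !mxE eqxx ltn_eqF // mul0r subr0.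
  apply/is_trig_mxP => i j ij; rewrite !mxE.
  have -> : (j == i) = false by rewrite -val_eqE /= gtn_eqF.
  by rewrite (_ : (i == j.+1 :> nat) = false) ?mul0r ?subrr // ltn_eqF // ltnS ltnW.
have UME (l i : 'I_k.+1) : (U *m M) l i =
    x i ^+ b l - (l < k)%:R * x k ^+ (b l - b l.+1)%N * x i ^+ b l.+1.
  rewrite !mxE (eq_bigr (fun j => (j == l)%:R * x i ^+ b j -
     (j == l.+1 :> nat)%:R * (x k ^+ (b l - b l.+1)%N * x i ^+ b l.+1))); last first.
    move=> j _; rewrite !mxE mulrBl [l == j]eq_sym; congr (_ - _).
    by case: eqP => [->|_]; rewrite ?mul0r // !mul1r.
  rewrite sumrB (bigD1 l) //= eqxx mul1r big1 ?addr0; last first.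
    by move=> j /negPf->; rewrite mul0r.
  congr (_ - _); rewrite -mulr_suml -mulrA; congr (_ * _).
  case: ltnP => lk.
    have lk1 : (l.+1 < k.+1)%N by [].
    rewrite (bigD1 (Ordinal lk1)) //= eqxx big1 ?addr0 // => j.
    by rewrite -val_eqE /= => /negPf->.
  rewrite big1 // => j _; rewrite ltn_eqF // (leq_trans (ltn_ord j)) //.
have -> : alternant k.+1 la = \det (U *m M) by rewrite det_mulmx detU mul1r.
have colE : \det (U *m M) = x k ^+ la k *
    \det (\matrix_(l < k, i < k) ((x i - x k) *
      \sum_(p < N | (la l.+1 <= p <= la l)%N)
         x k ^+ (la l - p)%N * x i ^+ (p + (k.-1 - l))%N)).
  rewrite (expand_det_col _ ord_max) (bigD1 ord_max) //= big1 ?addr0.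
    rewrite UME /= ltnn !mul0r subr0 /cofactor -signr_odd oddD addbb expr0 mul1r.
    congr (_ * _); first by rewrite /b subnn addn0.
    congr (@determinant R k _).
    apply/matrixP => l i; rewrite 2!mxE UME mxE.
    have lE : lift ord_max l = l :> nat by rewrite lift_max.
    have iE : lift ord_max i = i :> nat by rewrite lift_max.
    rewrite lE iE ltn_ord mul1r.
    have bl : (b l.+1 < b l)%N by exact: b_dec.
    (* The entry is divisible by [x i - x k]. In the geometric quotient the exponent of [x i] runs
       from [b l.+1] to [b l - 1]; writing it as [p + (k.-1 - l)] lets [p] run from [la l.+1] to
       [la l], which is the interlacing condition. *)
    rewrite -{1}(subnKC (ltnW bl)) exprD [x i ^+ _ * _]mulrC -mulrBl subrXX -mulrA.
    congr (_ * _); rewrite mulr_suml.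
    rewrite -(big_mkord (fun p => (la l.+1 <= p <= la l)%N)
       (fun p => x k ^+ (la l - p)%N * x i ^+ (p + (k.-1 - l))%N)).
    rewrite (eq_bigl (fun p => (la l.+1 <= p)%N && (p < (la l).+1)%N)) //.
    rewrite -(big_nat_widen _ _ _ (fun p => (la l.+1 <= p)%N)) //.
    rewrite -(big_nat_widenl _ _ _ predT) //.
    rewrite -{1}[la l.+1]add0n big_addn big_nat_rev /= big_mkord add0n.
    have lk := ltn_ord l; have ld := la_dec _ lk.
    have dE : (b l - b l.+1 = (la l).+1 - la l.+1)%N by rewrite /b; lia.
    rewrite dE; apply: eq_bigr => j _; have jk := ltn_ord j.
    rewrite [x k ^+ _ * _]mulrC mulrAC -exprD; congr (x i ^+ _ * x k ^+ _); rewrite /b; lia.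
  move=> l ln; rewrite UME.
  have lk : (l < k)%N by rewrite ltn_neqAle -ltnS ltn_ord andbT; move: ln; rewrite -val_eqE.
  by rewrite lk mul1r -exprD subnK ?subrr ?mul0r // ltnW // b_dec.
rewrite colE; set M' := \matrix_(l, i) _.
have -> : M' = \matrix_(l, i) \sum_(p < N) ((x i - x k) * (x k ^+ (la l - p)%N *
    ((la l.+1 <= p <= la l)%N%:R * x i ^+ (p + (k.-1 - l))%N))).
  apply/matrixP => l i; rewrite !mxE mulr_sumr big_mkcond; apply: eq_bigr => p _.
  by case: ifP => _; rewrite ?mul1r // mul0r !mulr0.
rewrite det_sum_rows !mulr_sumr [RHS]big_mkcond; apply: eq_bigr => f _.
have -> : \det (\matrix_(l, i) ((x i - x k) * (x k ^+ (la l - f l)%N *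
    ((la l.+1 <= f l <= la l)%N%:R * x i ^+ (f l + (k.-1 - l))%N)))) =
  (\prod_(i < k) (x i - x k)) * ((\prod_(l < k) x k ^+ (la l - f l)%N) *
   ((\prod_(l < k) (la l.+1 <= f l <= la l)%N%:R) *
   alternant k (fun l => nth 0 [seq val (f i) | i <- enum 'I_k] l)%N)).
  rewrite /alternant /determinant !mulr_sumr; apply: eq_bigr => s _.
  rewrite 3![in RHS](mulrCA _ ((-1) ^+ s)).
  congr (_ * _).
  rewrite [\prod_(i < k) (x i - x k)](reindex_inj (@perm_inj _ s)) /= -!big_split /=.
  apply: eq_bigr => l _; rewrite !mxE nth_ffun_enum.
  by rewrite !mulrA.
case: ifP => [/forallP fP|/negbT].
  rewrite [X in X * alternant _ _]big1 ?mul1r; last by move=> l _; rewrite fP.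
  by rewrite mulrCA !mulrA.
rewrite negb_forall => /existsP[l /negPf lP].
by rewrite [X in X * alternant _ _](bigD1 l) //= lP !mul0r !mulr0.
Qed.

Lemma alternant_swap k (r0 r1 : 'I_k) (b b' : nat -> nat) : r0 != r1 ->
    (forall l : 'I_k, b' l + (k.-1 - l) =
       b (tperm r0 r1 l) + (k.-1 - tperm r0 r1 l))%N ->
  alternant k b' = - alternant k b.
Proof.
move=> r01 bb'; rewrite /alternant -[RHS]mulN1r.
have -> : -1 = \det (perm_mx (tperm r0 r1) : 'M[R]_k) by rewrite det_perm odd_tperm r01.
rewrite -det_mulmx -row_permE; congr (\det _); apply/matrixP => l i.
by rewrite !mxE bb'.
Qed.

End Alternants.

(** * Semistandard tableaux by removal of the largest entry *)

Section SemistandardTableaux.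
Local Open Scope nat_scope.
Implicit Types (la mu : seq nat) (T : seq (seq nat)).

Definition row_of (A : Type) (T : seq (seq A)) i := nth [::] T i.

Definition nonincr la := forall i, nth 0 la i.+1 <= nth 0 la i.

(* Semistandard fillings with entries < k whose shape may have empty rows. *)
Definition semistd k la T := [/\ shape T = la,
  forall i, all (fun e => e < k) (row_of T i),
  forall i, sorted leq (row_of T i) &
  forall i j, j < size (row_of T i.+1) ->
    nth 0 (row_of T i) j < nth 0 (row_of T i.+1) j].

Definition interlacing k la : seq (seq nat) :=
  [seq [seq val (f i) | i <- enum 'I_k] |
    f : {ffun 'I_k -> 'I_(head 0 la).+1} <- enum {ffun 'I_k -> 'I_(head 0 la).+1}
    & [forall l : 'I_k, nth 0 la l.+1 <= f l <= nth 0 la l]].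

Definition add_strip k la T : seq (seq nat) :=
  mkseq (fun i => row_of T i ++ nseq (nth 0 la i - size (row_of T i)) k) k.+1.

Definition remove_strip k T : seq (seq nat) :=
  [seq [seq e <- r | e < k] | r <- take k T].

(** The Gelfand-Tsetlin recursion: deleting the entries [k'] leaves a shape that interlaces [la].
    Empty rows are kept so that the number of rows is always [k], the size of the alternant. *)
Fixpoint ssyts k la : seq (seq (seq nat)) :=
  if k is k'.+1 then
    [seq add_strip k' la T | mu <- interlacing k' la, T <- ssyts k' mu]
  else [:: [::]].

Lemma nonincr_head la i : nonincr la -> nth 0 la i <= head 0 la.
Proof.
move=> dec; rewrite -nth0; elim: i => // i; exact: leq_trans (dec i).
Qed.

Lemma mem_interlacing k la mu : nonincr la ->
  mu \in interlacing k la <->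
  size mu = k /\ forall l, l < k -> nth 0 la l.+1 <= nth 0 mu l <= nth 0 la l.
Proof.
move=> dec; split.
  case/mapP => f; rewrite mem_filter => /andP[/forallP fP _] ->.
  rewrite size_map size_enum_ord; split => // l lk.
  have := fP (Ordinal lk).
  by rewrite -(nth_ffun_enum f (Ordinal lk)).
move=> [smu muP]; apply/mapP.
have muN (l : 'I_k) : nth 0 mu l < (head 0 la).+1.
  by rewrite ltnS (leq_trans _ (nonincr_head l dec)) //; have /andP[] := muP l (ltn_ord l).
exists [ffun l => Ordinal (muN l)].
  rewrite mem_filter mem_enum inE andbT; apply/forallP => l; rewrite ffunE /=.
  exact: muP.
apply: (@eq_from_nth _ 0); first by rewrite size_map size_enum_ord.
move=> l; rewrite smu => lk.
by rewrite (nth_ffun_enum _ (Ordinal lk)) ffunE.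
Qed.

Lemma interlacing_uniq k la : uniq (interlacing k la).
Proof.
rewrite map_inj_uniq; first exact/filter_uniq/enum_uniq.
move=> f g fg.
apply/ffunP => l; apply: val_inj.
by have := congr1 (nth 0 ^~ l) fg; rewrite !nth_ffun_enum.
Qed.

Lemma interlacing_nonincr k la mu :
  nonincr la -> mu \in interlacing k la -> nonincr mu.
Proof.
move=> dec /(mem_interlacing _ _ dec)[smu muP] l.
case: (ltnP l.+1 k) => lk; last by rewrite nth_default ?smu.
have /andP[_ h1] := muP _ lk; have /andP[h2 _] := muP _ (ltnW lk).
exact: leq_trans h1 h2.
Qed.

Lemma sorted_split_max k s : sorted leq s -> all (fun e => e < k.+1) s ->
  s = [seq e <- s | e < k] ++ nseq (size s - size [seq e <- s | e < k]) k.
Proof.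
elim: s => //= a s IH pas /andP[ak sk].
have ss := path_sorted pas.
case: ltnP => ka /=; first by rewrite {1}(IH ss sk).
have aE : a = k by apply/eqP; rewrite eqn_leq -ltnS ak.
have -> : s = nseq (size s) k.
  apply/all_pred1P/allP => e es /=; rewrite eqn_leq -ltnS (allP sk) //=.
  by rewrite -aE (allP (order_path_min leq_trans pas)).
have -> : [seq e <- nseq (size s) k | e < k] = [::].
  by rewrite filter_nseq ltnn.
by rewrite aE subn0 size_nseq.
Qed.

Lemma row_add_strip k la T i : i <= k ->
  row_of (add_strip k la T) i = row_of T i ++ nseq (nth 0 la i - size (row_of T i)) k.
Proof. by move=> ik; rewrite /row_of nth_mkseq. Qed.

Lemma size_row k la T i : semistd k la T -> size (row_of T i) = nth 0 la i.
Proof. by case=> <- _ _ _; rewrite nth_shape. Qed.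

Lemma add_stripK k la T : size T = k ->
  (forall i, all (fun e => e < k) (row_of T i)) ->
  remove_strip k (add_strip k la T) = T.
Proof.
move=> sT Tk; apply: (@eq_from_nth _ [::]).
  by rewrite size_map size_take size_mkseq ltnSn sT.
move=> i; rewrite size_map size_take size_mkseq ltnSn => ik.
rewrite (nth_map [::]) ?size_take ?size_mkseq ?ltnSn // nth_take //.
rewrite -/(row_of (add_strip k la T) i) row_add_strip ?(ltnW ik) // filter_cat.
rewrite filter_nseq ltnn cats0; exact/all_filterP/Tk.
Qed.

(** Each step down a column raises the entry by at least one. Consequently the bottom row of a
    tableau with [k + 1] rows and entries at most [k] contains only [k], and it vanishes with the
    strip. *)
Lemma semistd_ge k la T i j : semistd k la T -> nonincr la ->
  j < size (row_of T i) -> i <= nth 0 (row_of T i) j.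
Proof.
move=> Tss dec; elim: i => // i IH ji.
have [_ _ _ Tc] := Tss.
apply: leq_ltn_trans (Tc _ _ ji); apply: IH.
by apply: leq_trans ji _; rewrite !(size_row _ Tss).
Qed.

Lemma remove_stripK k la T : nonincr la -> size la = k.+1 -> semistd k.+1 la T ->
  [/\ shape (remove_strip k T) \in interlacing k la,
      semistd k (shape (remove_strip k T)) (remove_strip k T) &
      add_strip k la (remove_strip k T) = T].
Proof.
move=> dec sla Tss; have [TE Tk Tr Tc] := Tss.
have sT : size T = k.+1 by rewrite -sla -TE size_map.
have rE i : row_of (remove_strip k T) i =
    if i < k then [seq e <- row_of T i | e < k] else [::].
  rewrite /row_of; case: ltnP => ik.
    by rewrite (nth_map [::]) ?nth_take // size_take sT ltnSn.
  by rewrite nth_default // size_map size_take sT ltnSn.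
have rc i := sorted_split_max (Tr i) (Tk i).
have rn i j : i < k -> j < size [seq e <- row_of T i | e < k] ->
    nth 0 [seq e <- row_of T i | e < k] j = nth 0 (row_of T i) j.
  by move=> ik jlt; rewrite [in RHS]rc nth_cat jlt.
have rk : all (fun e => e == k) (row_of T k).
  apply/(all_nthP 0) => j jk; rewrite eqn_leq (semistd_ge Tss) // andbT -ltnS.
  exact: (all_nthP 0 (Tk k)).
split.
- apply/(mem_interlacing _ _ dec); split; first by rewrite 2!size_map size_take sT ltnSn.
  move=> l lk; rewrite nth_shape -/(row_of _ _) rE lk -!(size_row _ Tss).
  rewrite size_filter count_size andbT.
  rewrite -(@size_takel (size (row_of T l.+1)) _ (row_of T l)); last by rewrite !(size_row _ Tss).
  set n0 := size (row_of T l.+1).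
  have n0le : n0 <= size (row_of T l) by rewrite /n0 !(size_row _ Tss).
  (* The first [n0] entries of row [l] lie above entries that are at most [k], so they survive the
     deletion; this is the lower interlacing bound. *)
  have : all (fun e => e < k) (take n0 (row_of T l)).
    apply/(all_nthP 0) => j; rewrite size_takel // => jn; rewrite nth_take //.
    by apply: leq_trans (Tc _ _ jn) _; rewrite -ltnS; exact: (all_nthP 0 (Tk l.+1)).
  rewrite all_count => /eqP <-.
  by rewrite -[X in _ <= count _ X](cat_take_drop n0) count_cat leq_addr.
- split => // [i|i|i j].
  + by rewrite rE; case: ifP => // _; exact: filter_all.
  + by rewrite rE; case: ifP => // _; rewrite sorted_filter //; exact: leq_trans.
  + rewrite !rE; case: (ltnP i.+1 k) => // ik; rewrite (ltnW ik) => ji.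
    have jT : j < size (row_of T i.+1).
      by apply: leq_trans ji _; rewrite size_filter count_size.
    rewrite (rn i.+1) //.
    have lt1 : nth 0 (row_of T i.+1) j < k.
      have /(all_nthP 0)/(_ j ji) := filter_all (fun e => e < k) (row_of T i.+1).
      by rewrite rn.
    have lt2 := Tc _ _ jT.
    (* If column [j] were outside the kept part of row [i], the entry there would be [k], although
       it lies above an entry smaller than [k]. *)
    rewrite rn ?(ltnW ik) // ltnNge; apply/negP => jge.
    have := rc i; set f := [seq e <- row_of T i | e < k] in jge *.
    move=> rT; have : nth 0 (row_of T i) j = k.
      rewrite rT nth_cat ltnNge jge /= nth_nseq ltn_sub2r //.
        by rewrite (leq_ltn_trans jge) // (leq_trans jT) // !(size_row _ Tss).
      by rewrite (leq_trans jT) // !(size_row _ Tss).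
    by move=> jE; move: (ltn_trans lt2 lt1); rewrite jE ltnn.
- apply: (@eq_from_nth _ [::]); first by rewrite size_mkseq sT.
  move=> i; rewrite size_mkseq ltnS => ik; rewrite -!/(row_of _ _).
  rewrite row_add_strip // rE; case: ltnP => ik'.
    by rewrite -(size_row _ Tss) [RHS]rc.
  have -> : i = k by apply/eqP; rewrite eqn_leq ik.
  by rewrite subn0 -(size_row _ Tss); apply/esym/all_pred1P.
Qed.

Lemma add_strip_semistd k la mu T : nonincr la -> size la = k.+1 ->
  mu \in interlacing k la -> semistd k mu T -> semistd k.+1 la (add_strip k la T).
Proof.
move=> dec sla /(mem_interlacing _ _ dec)[smu muP] Tss; have [TE Tk Tr Tc] := Tss.
have sT : size T = k by rewrite -smu -TE size_map.
have rsz i : size (row_of T i) <= nth 0 la i.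
  rewrite (size_row _ Tss); case: (ltnP i k) => ik; last by rewrite nth_default ?smu.
  by have /andP[] := muP _ ik.
have rE i : row_of (add_strip k la T) i =
   row_of T i ++ nseq (nth 0 la i - size (row_of T i)) k.
  case: (leqP i k) => ik; first exact: row_add_strip.
  rewrite /row_of nth_default ?size_mkseq // nth_default ?sT ?(ltnW ik) //.
  by rewrite (nth_default 0) ?sla.
have sE i : size (row_of (add_strip k la T) i) = nth 0 la i.
  by rewrite rE size_cat size_nseq subnKC.
split.
- apply: (@eq_from_nth _ 0); first by rewrite size_map size_mkseq sla.
  by move=> i _; rewrite nth_shape -/(row_of _ _) sE.
- move=> i; rewrite rE all_cat all_nseq ltnSn orbT andbT.
  by apply: sub_all (Tk i) => e /ltnW.
- move=> i; rewrite rE; set m := (_ - _).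
  rewrite -[nseq m k]cat0s; move: (Tr i) (Tk i); case: (row_of T i) => [|a s] /=.
    by move=> _ _; case: m => //= m; elim: m => //= m ->; rewrite leqnn.
  move=> pas /andP[ak sk]; rewrite cat_path pas /=.
  have : last a s < k by have := mem_last a s; rewrite inE => /predU1P[->//|/(allP sk)].
  case: m => //= m /ltnW->; by elim: m => //= m ->; rewrite leqnn.
- move=> i j; rewrite sE !rE => ji.
  have ik : i < k by rewrite -ltnS -sla ltnNge; apply/negP => h; rewrite nth_default ?(leq_trans h) in ji.
  have /andP[l1 l2] := muP _ ik.
  have jT : j < size (row_of T i) by rewrite (size_row _ Tss) (leq_trans ji).
  rewrite !nth_cat jT; case: (ltnP j (size (row_of T i.+1))) => ji1; first exact: Tc.
  rewrite nth_nseq ltn_sub2r // ?(all_nthP 0 (Tk i)) //.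
  exact: leq_ltn_trans ji1 ji.
Qed.

Lemma mem_ssyts k la T : nonincr la -> size la = k ->
  T \in ssyts k la <-> semistd k la T.
Proof.
elim: k la T => [|k IH] la T dec sla /=.
  rewrite (size0nil sla) inE; split=> [/eqP->|[/eqP]].
    by split=> // i; rewrite /row_of nth_nil.
  by rewrite -size_eq0 size_map size_eq0.
split.
  case/allpairsPdep => mu [T' [mula T'mu ->]].
  apply: (add_strip_semistd dec sla mula); apply/IH => //.
    exact: interlacing_nonincr mula.
  by have [] := (mem_interlacing _ _ dec).1 mula.
move=> Tss; have [mula T'ss TE] := remove_stripK dec sla Tss.
rewrite -TE; apply: allpairs_f_dep (mula) _; apply/IH => //.
  exact: interlacing_nonincr mula.
by have [] := (mem_interlacing _ _ dec).1 mula.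
Qed.

Lemma ssyts_uniq k la : nonincr la -> size la = k -> uniq (ssyts k la).
Proof.
elim: k la => // k IH la dec sla; apply: allpairs_uniq_dep.
- exact: interlacing_uniq.
- move=> mu mula; apply: IH; first exact: interlacing_nonincr mula.
  by have [] := (mem_interlacing _ _ dec).1 mula.
- move=> p q /allpairsPdep[mu [T [mula Tmu ->]]] /allpairsPdep[mu' [T' [mula' Tmu' ->]]] /=.
  have sz m : m \in interlacing k la -> size m = k /\ nonincr m.
    move=> mla; split; last exact: interlacing_nonincr mla.
    by have [] := (mem_interlacing _ _ dec).1 mla.
  have [smu dmu] := sz _ mula; have [smu' dmu'] := sz _ mula'.
  have [TE Tk _ _] := (mem_ssyts _ dmu smu).1 Tmu.
  have [TE' Tk' _ _] := (mem_ssyts _ dmu' smu').1 Tmu'.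
  have szT : size T = k by rewrite -smu -TE size_map.
  have szT' : size T' = k by rewrite -smu' -TE' size_map.
  move=> /(congr1 (remove_strip k)); rewrite !add_stripK // => eT.
  by rewrite -TE -TE' eT.
Qed.

End SemistandardTableaux.

Section SchurAlternant.
Local Open Scope ring_scope.
Variable R : comNzRingType.
Variable x : nat -> R.

Lemma prod_add_strip k la T : size T = k -> size la = k.+1 ->
    (forall i, (i < k)%N -> (size (row_of T i) <= nth 0%N la i)%N) ->
  \prod_(e <- flatten (add_strip k la T)) x e =
  x k ^+ nth 0%N la k * (\prod_(l < k) x k ^+ (nth 0%N la l - nth 0%N (shape T) l)%N) *
  \prod_(e <- flatten T) x e.
Proof.
move=> sT sla TP.
have flE (T' : seq (seq nat)) : \prod_(e <- flatten T') x e =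
    \prod_(i < size T') \prod_(e <- row_of T' i) x e.
  by rewrite big_flatten (big_nth [::]) big_mkord.
rewrite !flE size_mkseq big_ord_recr /= sT.
rewrite row_add_strip // [row_of T k]nth_default ?sT //= subn0.
rewrite mulrC big_nseq iter_mulr_1 -mulrA; congr (_ * _).
rewrite -big_split /=; apply: eq_bigr => i _.
by rewrite row_add_strip ?(ltnW (ltn_ord i)) // big_cat /= big_nseq iter_mulr_1 mulrC nth_shape.
Qed.

(** The bialternant formula: the recursions for the alternant, the Vandermonde product and [ssyts]
    match term by term, because [interlacing] enumerates the same functions [f] as
    [alternant_rec]. *)
Lemma alternant_ssyts k la : nonincr la -> size la = k ->
  alternant x k (nth 0%N la) =
  vandermonde x k * \sum_(T <- ssyts k la) \prod_(e <- flatten T) x e.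
Proof.
elim: k la => [|k IH] la dec sla.
  rewrite /alternant det_mx00 /vandermonde big_ord0 /= big_seq1 /= big_nil mulr1 //.
rewrite (@alternant_rec _ _ k (head 0%N la).+1); last 2 first.
- by move=> l _; exact: dec.
- by move=> l; rewrite ltnS nonincr_head.
rewrite /vandermonde big_ord_recr /= mulrAC mulrC; congr (_ * _).
rewrite big_allpairs_dep /= mulr_sumr big_map big_filter big_enum_cond /=.
apply: eq_big => [f|f fP]; first by rewrite ?andbT.
set mu := [seq _ | i <- _].
have mula : mu \in interlacing k la.
  by apply/mapP; exists f => //; rewrite mem_filter mem_enum fP.
have [smu muP] := (mem_interlacing _ _ dec).1 mula.
have dmu := interlacing_nonincr dec mula.
rewrite (IH mu) // mulrCA; congr (_ * _); rewrite mulr_sumr big_seq [RHS]big_seq.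
apply: eq_bigr => T /(mem_ssyts _ dmu smu) Tss.
have [TE _ _ _] := Tss.
rewrite prod_add_strip //.
- rewrite TE; congr (_ * _ * _); apply: eq_bigr => l _.
  by rewrite /mu nth_ffun_enum.
- by rewrite -smu -TE size_map.
- by move=> i ik; rewrite (size_row _ Tss); have /andP[] := muP _ ik.
Qed.

End SchurAlternant.

Lemma entry_Some (A : Type) (x0 : A) (T : seq (seq A)) i j a :
  entry T i j = Some a <-> (j < size (row_of T i))%N /\ nth x0 (row_of T i) j = a.
Proof.
rewrite /entry -/(row_of T i); split=> [h|[h <-]].
  by split; [rewrite -onthTE h | exact: onth_nth].
by rewrite onthE (nth_map x0).
Qed.

Lemma is_partition_nonincr la : is_partition la -> nonincr la.
Proof.
case/andP => /(sortedP 0%N) las _ i; case: (ltnP i.+1 (size la)) => h; first exact: las.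
by rewrite nth_default.
Qed.

(** * Padding partitions with zero parts *)

Section SchurPolynomial.
Local Open Scope nat_scope.

Definition bounded_ssyts k la :=
  [seq take (size la) T | T <- ssyts k (la ++ nseq (k - size la) 0)].

Lemma nth_pad (la : seq nat) d i : nth 0 (la ++ nseq d 0) i = nth 0 la i.
Proof.
rewrite nth_cat; case: ltnP => // h.
by rewrite nth_nseq if_same nth_default.
Qed.

Lemma shape_padE (A : Type) (T : seq (seq A)) la d : shape T = la ++ nseq d 0 ->
  T = take (size la) T ++ nseq d [::].
Proof.
move=> TE; rewrite -{1}(cat_take_drop (size la) T); congr (_ ++ _).
have : shape (drop (size la) T) = nseq d 0 by rewrite /shape map_drop -/(shape T) TE drop_size_cat.
elim: d (drop _ _) {TE} => [|d IH] [|r T'] //= [/size0nil-> /IH->//].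
Qed.

Lemma row_pad (A : Type) (T : seq (seq A)) d i : row_of (T ++ nseq d [::]) i = row_of T i.
Proof.
rewrite /row_of nth_cat; case: ltnP => // h.
by rewrite nth_nseq if_same nth_default.
Qed.

Lemma semistd_ssyt k la T : is_partition la -> size la <= k ->
  semistd k (la ++ nseq (k - size la) 0) (T ++ nseq (k - size la) [::]) <->
  [/\ ssyt T, shape T = la & all (fun e => e < k) (flatten T)].
Proof.
move=> laP lak; have dec := is_partition_nonincr laP; split.
- case; rewrite /shape map_cat map_nseq => /eqP.
  move=> TE Tk Tr Tc.
  have {}TE : shape T = la.
    have sT : size (shape T) = size la.
      move: (congr1 size (eqP TE)); rewrite !size_cat !size_nseq.
      by move/eqP; rewrite eqn_add2r => /eqP.
    by move: TE; rewrite eqseq_cat // => /andP[/eqP].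
  split=> //.
  + split; first by rewrite TE.
    * move=> i j a b /(entry_Some 0)[_ <-] /(entry_Some 0)[ji <-].
      by have /(sortedP 0) := Tr i; rewrite row_pad; apply.
    * move=> i j a b /(entry_Some 0)[_ <-] /(entry_Some 0)[ji <-].
      by have := Tc i j; rewrite !row_pad; apply.
  + apply/allP => e /flattenP[r /(nthP [::])[i _ <-]] er.
    by have := Tk i; rewrite row_pad => /allP; apply.
- case=> [[_ Tr Tc] TE Tk].
  have sT i : size (row_of T i) = nth 0 la i by rewrite -TE nth_shape.
  split.
  + by rewrite /shape map_cat map_nseq -/(shape _) TE.
  + move=> i; rewrite row_pad; apply/allP => e er; apply: (allP Tk).
    apply/flattenP; exists (row_of T i) => //.
    rewrite mem_nth // ltnNge; apply/negP => h.
    by rewrite /row_of nth_default in er.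
  + move=> i; rewrite row_pad; apply/(sortedP 0) => j ji.
    by apply: (Tr i j); apply/(entry_Some 0); split=> //; exact: ltnW.
  + move=> i j; rewrite !row_pad => ji.
    apply: (Tc i j); apply/(entry_Some 0); split=> //.
    by rewrite sT (leq_trans ji) // sT.
Qed.

Lemma mem_bounded_ssyts k la T : is_partition la -> size la <= k ->
  T \in bounded_ssyts k la <->
  [/\ ssyt T, shape T = la & all (fun e => e < k) (flatten T)].
Proof.
move=> laP lak; have dec := is_partition_nonincr laP.
have pdec : nonincr (la ++ nseq (k - size la) 0) by move=> i; rewrite !nth_pad.
have psz : size (la ++ nseq (k - size la) 0) = k by rewrite size_cat size_nseq subnKC.
rewrite -semistd_ssyt //; split.
  case/mapP => T' /(mem_ssyts _ pdec psz) T'ss ->.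
  have [T'E _ _ _] := T'ss.
  by rewrite -(shape_padE T'E).
move=> Tss; apply/mapP; exists (T ++ nseq (k - size la) [::]); first exact/mem_ssyts.
have sT : size T = size la.
  have [/(congr1 size)] := Tss; rewrite !(size_map, size_cat, size_nseq).
  by move/eqP; rewrite eqn_add2r => /eqP.
by rewrite -sT take_size_cat.
Qed.

Lemma bounded_ssyts_uniq k la : is_partition la -> size la <= k ->
  uniq (bounded_ssyts k la).
Proof.
move=> laP lak; have dec := is_partition_nonincr laP.
have pdec : nonincr (la ++ nseq (k - size la) 0) by move=> i; rewrite !nth_pad.
have psz : size (la ++ nseq (k - size la) 0) = k by rewrite size_cat size_nseq subnKC.
rewrite map_inj_in_uniq ?ssyts_uniq // => T1 T2.
move=> /(mem_ssyts _ pdec psz)[+ _ _ _] /(mem_ssyts _ pdec psz)[+ _ _ _].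
by move=> /shape_padE + /shape_padE + eT => -> ->; rewrite eT.
Qed.

Lemma alternant_partition (R : comNzRingType) (x : nat -> R) k la :
    is_partition la -> size la <= k ->
  alternant x k (nth 0 la) =
  (vandermonde x k * \sum_(T <- bounded_ssyts k la) \prod_(e <- flatten T) x e)%R.
Proof.
move=> laP lak; have dec := is_partition_nonincr laP.
have pdec : nonincr (la ++ nseq (k - size la) 0) by move=> i; rewrite !nth_pad.
have psz : size (la ++ nseq (k - size la) 0) = k by rewrite size_cat size_nseq subnKC.
have -> : alternant x k (nth 0 la) = alternant x k (nth 0 (la ++ nseq (k - size la) 0)).
  by congr (\det _)%R; apply/matrixP => l i; rewrite !mxE nth_pad.
rewrite alternant_ssyts // big_map; congr (_ * _)%R.
rewrite big_seq [RHS]big_seq; apply: eq_bigr => T /(mem_ssyts _ pdec psz)[/shape_padE TE _ _ _].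
rewrite {1}TE flatten_cat big_cat /= (_ : flatten (nseq _ _) = [::]) ?big_nil ?mulr1 //.
by elim: (k - _)%N => //= d ->.
Qed.

End SchurPolynomial.

(** * Exchanging two consecutive colours *)

Section UnitIntervalOrder.
Variables (n : nat) (P : rel 'I_n).
Hypothesis hP : natural_unit_interval_order P.
Local Open Scope nat_scope.

(** The two ends are moved separately. If [w > z] were not above [y], it would be incomparable to
    both [y] and [z], and the unit interval condition would force [w < z]; the lower end is
    symmetric. Every later use of that condition goes through this lemma. *)
Lemma nuio_mono (x y z w : 'I_n) : P y z -> x <= y -> z <= w -> P x w.
Proof.
move=> Pyz xy zw; have yz := nuio_natural hP Pyz.
have Pyw : P y w.
  have [/val_inj<-//|zw'] := eqVneq (z : nat) w.
  have {zw'}zw : z < w by rewrite ltn_neqAle zw'.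
  apply: contraT => nPyw.
  have iwy : incomp P w y.
    apply/and3P; split=> //; first by rewrite neq_ltn (ltn_trans yz zw) orbT.
    by apply/negP => /(nuio_natural hP); rewrite ltnNge (ltnW (ltn_trans yz zw)).
  case: (boolP (P z w)) => [Pzw|nPzw].
    by rewrite (nuio_trans hP Pyz Pzw) in nPyw.
  have iwz : incomp P w z.
    apply/and3P; split=> //; first by rewrite neq_ltn zw orbT.
    by apply/negP => /(nuio_natural hP); rewrite ltnNge (ltnW zw).
  by have [_] := nuio_unit hP Pyz iwy iwz; rewrite ltnNge (ltnW zw).
have yw := nuio_natural hP Pyw.
have [/val_inj->//|xy'] := eqVneq (x : nat) y.
have {xy'}xy : x < y by rewrite ltn_neqAle xy'.
apply: contraT => nPxw.
have ixw : incomp P x w.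
  apply/and3P; split=> //; first by rewrite neq_ltn (ltn_trans xy yw).
  by apply/negP => /(nuio_natural hP); rewrite ltnNge (ltnW (ltn_trans xy yw)).
case: (boolP (P x y)) => [Pxy|nPxy].
  by rewrite (nuio_trans hP Pxy Pyw) in nPxw.
have ixy : incomp P x y.
  apply/and3P; split=> //; first by rewrite neq_ltn xy.
  by apply/negP => /(nuio_natural hP); rewrite ltnNge (ltnW xy).
by have [] := nuio_unit hP Pyw ixy ixw; rewrite ltnNge (ltnW xy).
Qed.

Lemma incomp_sym : symmetric (incomp P).
Proof. by move=> u v; rewrite /incomp eq_sym [~~ P u v && _]andbC. Qed.

Lemma incompF u v : P u v -> incomp P u v = false.
Proof. by move=> Puv; rewrite /incomp Puv andbF. Qed.

End UnitIntervalOrder.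

Section Colorings.
Variables (n k : nat) (P : rel 'I_n).
Hypothesis hP : natural_unit_interval_order P.
Local Open Scope nat_scope.
Implicit Types (c : {ffun 'I_n -> 'I_k}) (u v w : 'I_n).

Definition properb c := [forall u, forall v, incomp P u v ==> (c u != c v)].

Definition des c :=
  #|[set p : 'I_n * 'I_n | [&& incomp P p.1 p.2, p.1 < p.2 & c p.2 < c p.1]]|.

Lemma proper_neq c u v : properb c -> incomp P u v -> c u != c v.
Proof. by move=> /forallP/(_ u)/forallP/(_ v)/implyP. Qed.

Lemma proper_chain c u v : properb c -> c u = c v -> u < v -> P u v.
Proof.
move=> cP cuv uv; apply: contraT => nPuv.
have : incomp P u v.
  apply/and3P; split=> //; first by rewrite neq_ltn uv.
  by apply/negP => /(nuio_natural hP); rewrite ltnNge (ltnW uv).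
by move/(proper_neq cP); rewrite cuv eqxx.
Qed.

Section TwoColors.
Variables (r0 r1 : 'I_k).
Hypothesis r01 : r1 = r0.+1 :> nat.

Definition bicolored c := [set v | (c v == r0) || (c v == r1)].

Definition edge (W : {set 'I_n}) : rel 'I_n :=
  [rel u v | [&& u \in W, v \in W & incomp P u v]].

Definition component W v := [set u | connect (edge W) v u].

Definition unbalanced c v :=
  #|[set u in component (bicolored c) v | c u == r0]| !=
  #|[set u in component (bicolored c) v | c u == r1]|.

Definition flip (U : {set 'I_n}) c : {ffun 'I_n -> 'I_k} :=
  [ffun v => if (v \in U) && unbalanced c v then tperm r0 r1 (c v) else c v].

Lemma r0_neq_r1 : r0 != r1.
Proof. by rewrite -val_eqE /= r01 neq_ltn ltnSn. Qed.

Lemma edge_sym W : symmetric (edge W).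
Proof. by move=> u v; rewrite /edge /= incomp_sym andbCA. Qed.

Lemma edge_connect_sym W : connect_sym (edge W).
Proof. exact/sym_connect_sym/edge_sym. Qed.

Lemma component_eq W u v : connect (edge W) u v -> component W u = component W v.
Proof.
move=> uv; apply/setP => w; rewrite !inE.
exact: (same_connect (@edge_connect_sym W)).
Qed.

Lemma tperm_bicolored (a : 'I_k) :
  ((tperm r0 r1 a == r0) || (tperm r0 r1 a == r1)) = ((a == r0) || (a == r1)).
Proof. by case: tpermP => [->|->|_ _]; rewrite ?eqxx ?orbT. Qed.

Lemma bicolored_flip U c : bicolored (flip U c) = bicolored c.
Proof.
by apply/setP => v; rewrite !inE ffunE; case: ifP; rewrite ?tperm_bicolored.
Qed.

Lemma edge_color c u v : properb c -> edge (bicolored c) u v -> c v = tperm r0 r1 (c u).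
Proof.
move=> cP /and3P[]; rewrite !inE => uW vW /(proper_neq cP) uv.
move: uW vW uv => /orP[]/eqP-> /orP[]/eqP->; rewrite ?eqxx // => _.
  by rewrite tpermL.
by rewrite tpermR.
Qed.

(** Two right neighbours of [v] have the same colour and are therefore comparable; [nuio_mono] then
    puts [v] below the larger one. With the mirror statement, every vertex has at most one neighbour
    on each side. *)
Lemma edge_right_uniq c u v w : properb c ->
  edge (bicolored c) v u -> edge (bicolored c) v w -> v < u -> v < w -> u = w.
Proof.
move=> cP; wlog uw : u w / u < w.
  move=> H e1 e2 l1 l2; case: (ltngtP u w) => [||/val_inj//] h; first exact: H.
  by apply/esym/H.
move=> e1 e2 l1 l2.
have cuw : c u = c w by rewrite (edge_color cP e1) (edge_color cP e2).
have Pvw : P v w by apply: (nuio_mono hP (proper_chain cP cuw uw)) => //; exact: ltnW.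
by move: e2 => /and3P[_ _]; rewrite incompF.
Qed.

Lemma edge_left_uniq c u v w : properb c ->
  edge (bicolored c) u v -> edge (bicolored c) w v -> u < v -> w < v -> u = w.
Proof.
move=> cP; wlog uw : u w / u < w.
  move=> H e1 e2 l1 l2; case: (ltngtP u w) => [||/val_inj//] h; first exact: H.
  by apply/esym/H.
move=> e1 e2 l1 l2.
have cuw : c u = c w.
  by move: e1 e2; rewrite ![edge _ _ v]edge_sym => /(edge_color cP)-> /(edge_color cP)->.
have Puv : P u v by apply: (nuio_mono hP (proper_chain cP cuw uw)) => //; exact: ltnW.
by move: e1 => /and3P[_ _]; rewrite incompF.
Qed.

(** No edge jumps over a two-coloured vertex [v]: one end has the colour of [v], so it is comparable
    to [v], and [nuio_mono] makes the two ends comparable. A vertex without right neighbour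
    therefore ends its component. *)
Lemma max_component c v u : properb c -> v \in bicolored c ->
  (forall w, edge (bicolored c) v w -> w <= v) ->
  connect (edge (bicolored c)) v u -> u <= v.
Proof.
move=> cP vW vmax vu.
have cl : closed (edge (bicolored c)) [pred w : 'I_n | w <= v].
  apply: (intro_closed (@edge_connect_sym _)) => x y xy; rewrite !inE => xv.
  have [xE|xv'] := eqVneq x v; first by apply: vmax; rewrite -xE.
  have {xv'}xv : x < v by rewrite ltn_neqAle xv andbT.
  rewrite leqNgt; apply/negP => vy.
  have cx : c v = c x \/ c v = c y.
    rewrite (edge_color cP xy); move: (xy) vW => /and3P[+ _ _]; rewrite !inE.
    by move=> /orP[]/eqP-> /orP[]/eqP->; rewrite ?tpermL ?tpermR; tauto.
  suff Pxy : P x y by move: xy => /and3P[_ _]; rewrite incompF.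
  case: cx => cE.
    by apply: (nuio_mono hP (proper_chain cP (esym cE) xv)) => //; exact: ltnW.
  by apply: (nuio_mono hP (proper_chain cP cE vy)) => //; exact: ltnW.
by have := closed_connect cl vu; rewrite !inE leqnn => /esym.
Qed.

Definition up_edges c (K : {set 'I_n}) :=
  [set p : 'I_n * 'I_n | [&& p.1 \in K, edge (bicolored c) p.1 p.2 & p.1 < p.2]].

(* A component of the two-coloured graph is a path along which the colours alternate;
   an unbalanced one has an even number of edges, half of them ascending. *)
Lemma unbalanced_edges c v : properb c -> unbalanced c v ->
  #|[set p in up_edges c (component (bicolored c) v) | c p.1 < c p.2]| =
  #|[set p in up_edges c (component (bicolored c) v) | c p.2 < c p.1]|.
Proof.
move=> cP; rewrite /unbalanced; set K := component _ v; set W := bicolored c.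
case: (boolP (v \in W)) => vW; last first.
  move=> _; suff E0 p : p \in up_edges c K = false.
    by apply: eq_card => p; rewrite [LHS]inE [RHS]inE E0.
  rewrite !inE; apply/negP => /and3P[vp /and3P[pW _ _] _].
  have cl : closed (edge W) W.
    by apply: (intro_closed (@edge_connect_sym _)) => x y /and3P[].
  by rewrite (closed_connect cl vp) pW in vW.
have KW u : u \in K -> u \in W.
  rewrite inE => vu.
  have cl : closed (edge W) W.
    by apply: (intro_closed (@edge_connect_sym _)) => x y /and3P[].
  by rewrite -(closed_connect cl vu).
have Kcl x y : edge W x y -> x \in K -> y \in K.
  by rewrite !inE => xy vx; apply: connect_trans vx (connect1 xy).
set E := up_edges c K.
have EP p : p \in E -> [/\ p.1 \in K, p.2 \in K, edge W p.1 p.2 & p.1 < p.2].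
  by rewrite inE => /and3P[h1 h2 h3]; split=> //; exact: Kcl h2 h1.
have inj1 (a : pred ('I_n * 'I_n)) : {in [set p in E | a p] &, injective (@fst 'I_n 'I_n)}.
  move=> [p1 p2] [q1 q2]; rewrite !(inE, finset.in_setI) /= => /andP[/and3P[_ e1 l1] _] /andP[/and3P[_ e2 l2] _] pq.
  by move: e2 l2; rewrite -pq => e2 l2; rewrite (edge_right_uniq cP e1 e2 l1 l2).
have inj2 (a : pred ('I_n * 'I_n)) : {in [set p in E | a p] &, injective (@snd 'I_n 'I_n)}.
  move=> [p1 p2] [q1 q2]; rewrite !(inE, finset.in_setI) /= => /andP[/and3P[_ e1 l1] _] /andP[/and3P[_ e2 l2] _] pq.
  by move: e2 l2; rewrite -pq => e2 l2; rewrite (edge_left_uniq cP e1 e2 l1 l2).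
have colE u w : u \in K -> edge W u w ->
    ((c u < c w) = (c u == r0)) * ((c u < c w) = (c w == r1)) *
    ((c w < c u) = (c u == r1)) * ((c w < c u) = (c w == r0)).
  move=> /KW uW uw; rewrite (edge_color cP uw); move: uW; rewrite !inE.
  have n01 := r0_neq_r1; have n10 : r1 != r0 by rewrite eq_sym.
  move=> /orP[]/eqP->; rewrite ?tpermL ?tpermR !eqxx ?(negPf n01) ?(negPf n10) r01 ltnSn;
    by rewrite (ltnNge _ r0) leqnSn.
(* [a] and [b] count the vertices of [K] coloured [r0] and [r1]. An edge is determined by either of
   its ends, and the two ends carry the two colours, so ascending and descending edges each number
   at most [minn a b]. *)
set a := #|_|; set b := #|_| => ab.
have asc_a : #|[set p in E | c p.1 < c p.2]| <= a.
  rewrite -(card_in_imset (inj1 _)); apply/subset_leq_card/fintype.subsetP => u /imsetP[p].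
  rewrite inE => /andP[/EP[p1 p2 pe pl] pc] ->; rewrite inE p1.
  by move: pc; have [[[-> _] _] _] := colE _ _ p1 pe.
have asc_b : #|[set p in E | c p.1 < c p.2]| <= b.
  rewrite -(card_in_imset (inj2 _)); apply/subset_leq_card/fintype.subsetP => u /imsetP[p].
  rewrite inE => /andP[/EP[p1 p2 pe pl] pc] ->; rewrite inE p2.
  by move: pc; have [[[_ ->] _] _] := colE _ _ p1 pe.
have des_b : #|[set p in E | c p.2 < c p.1]| <= b.
  rewrite -(card_in_imset (inj1 _)); apply/subset_leq_card/fintype.subsetP => u /imsetP[p].
  rewrite inE => /andP[/EP[p1 p2 pe pl] pc] ->; rewrite inE p1.
  by move: pc; have [[_ ->] _] := colE _ _ p1 pe.
have des_a : #|[set p in E | c p.2 < c p.1]| <= a.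
  rewrite -(card_in_imset (inj2 _)); apply/subset_leq_card/fintype.subsetP => u /imsetP[p].
  rewrite inE => /andP[/EP[p1 p2 pe pl] pc] ->; rewrite inE p2.
  by move: pc; have [_ ->] := colE _ _ p1 pe.
have KE : #|K| = a + b.
  rewrite -[LHS](cardsID [set u | c u == r0]); congr (_ + _).
    by apply: eq_card => u; rewrite !inE.
  apply: eq_card => u; rewrite finset.in_setD 2!inE; case: (boolP (u \in K)) => uK; rewrite ?andbF //.
  have := KW _ uK; rewrite inE => /orP[]/eqP->; rewrite !eqxx ?(negPf r0_neq_r1) //.
  by rewrite eq_sym r0_neq_r1.
have EE : #|E| = #|[set p in E | c p.1 < c p.2]| + #|[set p in E | c p.2 < c p.1]|.
  rewrite -[LHS](cardsID [set p | c p.1 < c p.2]); congr (_ + _).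
    by apply: eq_card => p; rewrite !inE.
  apply: eq_card => p; rewrite finset.in_setD 2!inE; case: (boolP (p \in E)) => pE; rewrite ?andbF //=.
  have [_ _ /and3P[_ _ /(proper_neq cP) pc] _] := EP _ pE.
  by move: pc; rewrite -val_eqE /= andbT; case: ltngtP.
(* Every vertex but the largest is the left end of an edge. Hence the two counts add up to at least
   [a + b - 1], which for [a != b] forces both to equal [minn a b]. *)
have KE1 : #|K| <= #|E| + 1.
  pose top := [set u in K | [forall w, edge W u w ==> (w <= u)]].
  have KT : K \subset [set p.1 | p in E] :|: top.
    apply/fintype.subsetP => u uK; rewrite finset.in_setU orbC; case: (boolP (u \in top)) => //=.
    rewrite inE uK /= negb_forall => /existsP[w]; rewrite negb_imply -ltnNge => /andP[uw lt_uw].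
    by apply/imsetP; exists (u, w) => //; rewrite inE /= uK lt_uw andbT; exact: uw.
  apply: leq_trans (subset_leq_card KT) _; apply: leq_trans (leq_card_setU _ _) _.
  rewrite leq_add ?leq_imset_card //; apply/card_le1_eqP => y z yt zt.
  have topP u w : u \in top -> w \in K -> w <= u.
    rewrite inE => /andP[uK /forallP uT] wK.
    apply: (max_component cP (KW _ uK)); first by move=> q uq; exact: (implyP (uT q)).
    move: uK wK; rewrite !inE => vu vw.
    by apply: connect_trans vw; rewrite edge_connect_sym.
  have yK : y \in K by move: yt; rewrite inE => /andP[].
  have zK : z \in K by move: zt; rewrite inE => /andP[].
  by apply/val_inj/eqP; rewrite eqn_leq (topP _ _ zt yK) (topP _ _ yt zK).
by move/eqP: ab; lia.
Qed.

Section Flip.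
Variables (c : {ffun 'I_n -> 'I_k}) (U : {set 'I_n}).
Hypotheses (cP : properb c)
  (Ucl : closed (edge (bicolored c)) U).
Let W := bicolored c.
Let F v := (v \in U) && unbalanced c v.
Let c' := flip U c.

Lemma unbalanced_connect u v :
  connect (edge (bicolored c)) u v -> unbalanced c u = unbalanced c v.
Proof. by rewrite /unbalanced => /component_eq->. Qed.

Lemma flipped_connect u v : connect (edge W) u v -> F u = F v.
Proof. by move=> uv; rewrite /F (closed_connect Ucl uv) (unbalanced_connect uv). Qed.

Lemma flipE v : c' v = if F v then tperm r0 r1 (c v) else c v.
Proof. by rewrite ffunE. Qed.

Lemma flip_out v : v \notin W -> c' v = c v.
Proof.
rewrite flipE inE negb_or => /andP[h0 h1]; case: ifP => // _.
by rewrite tpermD // eq_sym.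
Qed.

Lemma flip_proper : properb c'.
Proof.
apply/forallP => u; apply/forallP => v; apply/implyP => uv.
have cuv := proper_neq cP uv.
case: (boolP (u \in W)) => uW; case: (boolP (v \in W)) => vW.
- have e : edge W u v by apply/and3P.
  rewrite !flipE (flipped_connect (connect1 e)); case: ifP => // _.
  by rewrite (inj_eq perm_inj).
- have : u \in bicolored c' by rewrite bicolored_flip.
  rewrite (flip_out vW); move: vW; rewrite !inE => vW uW'.
  by apply: contraNN vW => /eqP <-.
- have : v \in bicolored c' by rewrite bicolored_flip.
  rewrite (flip_out uW); move: uW; rewrite !inE => uW vW'.
  by apply: contraNN uW => /eqP ->.
- by rewrite !flip_out.
Qed.

Lemma card_flip_component v a : F v ->
  #|[set u in component W v | c' u == a]| =
  #|[set u in component W v | c u == tperm r0 r1 a]|.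
Proof.
move=> Fv; apply: eq_card => u; rewrite !inE; case: (boolP (connect _ _ _)) => //= vu.
by rewrite flipE -(flipped_connect vu) Fv -(inj_eq (@perm_inj _ (tperm r0 r1))) tpermK.
Qed.

Lemma unbalanced_flip v : unbalanced c' v = unbalanced c v.
Proof.
rewrite /unbalanced bicolored_flip -/W; case: (boolP (F v)) => Fv.
  by rewrite !card_flip_component // tpermL tpermR eq_sym.
congr (_ != _); apply: eq_card => u; rewrite !inE; case: (boolP (connect _ _ _)) => //= vu;
  by rewrite flipE -(flipped_connect vu) (negPf Fv).
Qed.

Lemma flipK : flip U c' = c.
Proof.
apply/ffunP => v; rewrite ffunE unbalanced_flip flipE /F.
by case: (_ && _) => //; rewrite tpermK.
Qed.

(** Components are the fibres of the canonical root, so cardinals may be compared fibrewise; [g] is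
    the identity for vertices and the first end for edges. *)
Lemma card_by_component (A : finType) (g : A -> 'I_n) (D D' : {set A}) :
  (forall v, #|[set a in D | g a \in component W v]| =
             #|[set a in D' | g a \in component W v]|) -> #|D| = #|D'|.
Proof.
move=> DD'; rewrite -!sum1_card.
rewrite (partition_big (fun a => fingraph.root (edge W) (g a)) predT) //=.
rewrite [RHS](partition_big (fun a => fingraph.root (edge W) (g a)) predT) //=.
apply: eq_bigr => v _; rewrite !sum1dep_card.
have rootE (X : {set A}) : fingraph.root (edge W) v = v ->
    [set a | (a \in X) && (fingraph.root (edge W) (g a) == v)] =
    [set a in X | g a \in component W v].
  move=> rv; apply/setP => a; rewrite !inE; case: (a \in X) => //=.
  by rewrite -(fingraph.root_connect (@edge_connect_sym W)) rv eq_sym.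
have [rv|rv] := eqVneq (fingraph.root (edge W) v) v; first by rewrite !rootE.
have rE (X : {set A}) : #|[set a | (a \in X) && (fingraph.root (edge W) (g a) == v)]| = 0.
  apply: eq_card0 => a; rewrite !inE; apply/negP => /andP[_ /eqP av].
  by case/eqP: rv; rewrite -av (fingraph.root_root (@edge_connect_sym W)).
by rewrite !rE.
Qed.

(** On an unbalanced component the colours are exchanged; on a balanced one nothing moves, but its
    two counts agree. *)
Lemma card_flip a :
  #|[set v in U | c' v == a]| = #|[set v in U | c v == tperm r0 r1 a]|.
Proof.
apply: (@card_by_component _ id) => v.
have setE (d : 'I_n -> 'I_k) b : [set u in [set w in U | d w == b] | u \in component W v] =
    if v \in U then [set u in component W v | d u == b] else finset.set0.
  apply/setP => u; rewrite 2!inE; case: (boolP (u \in component W v)) => uv; last first.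
    by rewrite andbF; case: ifP => _; rewrite [RHS]inE ?(negPf uv).
  have uvc : connect (edge W) v u by rewrite inE in uv.
  by rewrite -(closed_connect Ucl uvc) andbT; case: ifP => _; rewrite [RHS]inE ?uv.
rewrite (setE c') (setE c); case: ifP => // vU.
case: (boolP (unbalanced c v)) => vb; first by rewrite card_flip_component // /F vU.
have -> : [set u in component W v | c' u == a] = [set u in component W v | c u == a].
  apply/setP => u; rewrite !inE; case: (boolP (connect _ _ _)) => //= vu.
  by rewrite flipE -(flipped_connect vu) /F (negPf vb) andbF.
move: vb; rewrite /unbalanced negbK -/W => /eqP vb.
by case: tpermP => [->|->|].
Qed.

Lemma flip_des : des c' = des c.
Proof.
(* [H] holds the edges inside exchanged components. For any other edge at most one end is
   recoloured, and then the other end has a third colour, which cannot lie between [r0] and [r1]. *)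
pose H := [set p : 'I_n * 'I_n | F p.1 && edge W p.1 p.2].
rewrite /des -[LHS](cardsID H) -[RHS](cardsID H); congr (_ + _); last first.
  apply: eq_card => p; rewrite !inE.
  case: (boolP (F p.1 && _)) => //= pH.
  case: (boolP (incomp P p.1 p.2)) => //= pG; case: ltnP => //= _.
  case: (boolP (p.1 \in W)) => p1W; case: (boolP (p.2 \in W)) => p2W.
  - have e : edge W p.1 p.2 by apply/and3P.
    move: pH; rewrite e andbT => pF.
    by rewrite !flipE -(flipped_connect (connect1 e)) (negPf pF).
  - have : p.1 \in bicolored c' by rewrite bicolored_flip.
    rewrite (flip_out p2W); move: p1W p2W; rewrite !inE -!val_eqE /= !r01; lia.
  - have : p.2 \in bicolored c' by rewrite bicolored_flip.
    rewrite (flip_out p1W); move: p1W p2W; rewrite !inE -!val_eqE /= !r01; lia.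
  - by rewrite !flip_out.
apply: (@card_by_component _ fst) => v.
case: (boolP (F v)) => Fv; last first.
  by rewrite !eq_card0 // => p; rewrite !inE; apply/negP => /andP[/andP[_ /andP[Fp _]]];
    move=> /flipped_connect; rewrite (negPf Fv) Fp.
have /andP[_ vb] := Fv.
(* Inside an exchanged component the descents of [c'] are the ascents of [c], as many as its
   descents. *)
transitivity #|[set p in up_edges c (component W v) | c p.1 < c p.2]|.
  apply: eq_card => p; rewrite !inE.
  case: (boolP (connect _ v p.1)) => vp; rewrite ?andbF //= andbT -(flipped_connect vp) Fv /=.
  case: (boolP (edge W p.1 p.2)) => e; rewrite ?andbF //=.
  rewrite !flipE -(flipped_connect (connect1 e)) -(flipped_connect vp) Fv.
  move: (e) => /and3P[p1W p2W ->] /=; case: (p.1 < p.2) => //=.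
  by move: p1W p2W; rewrite !inE andbT => /orP[]/eqP-> /orP[]/eqP->; rewrite ?tpermL ?tpermR ?ltnn.
apply: etrans (unbalanced_edges cP vb) _.
apply: eq_card => p; rewrite !inE.
case: (boolP (connect _ v p.1)) => vp; rewrite ?andbF //= andbT -(flipped_connect vp) Fv /=.
case: (boolP (edge W p.1 p.2)) => e; rewrite ?andbF //=.
by move: e => /and3P[_ _ ->] /=; rewrite andbT.
Qed.

End Flip.

End TwoColors.

Definition class_size c (l : nat) := #|[set v | c v == l :> nat]|.

(** * Symmetry of the colouring polynomial *)

Section Symmetry.
Variables (R : comNzRingType) (t : R).
Implicit Type x : 'I_k -> R.

Definition des_poly x : R :=
  (\sum_(c | properb c) t ^+ des c * \prod_v x (c v))%R.

Lemma prod_class_size c x :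
  (\prod_v x (c v) = \prod_(a < k) x a ^+ class_size c a)%R.
Proof.
rewrite (partition_big c predT) //=; apply: eq_bigr => a _.
rewrite (eq_bigr (fun=> x a)) => [|v /eqP-> //].
by rewrite prodr_const; congr (_ ^+ _)%R; apply: eq_card => v; rewrite !inE.
Qed.

Lemma des_poly_adjacent (r0 r1 : 'I_k) x : r1 = r0.+1 :> nat ->
  des_poly (x \o tperm r0 r1) = des_poly x.
Proof.
move=> r01; pose fl := flip r0 r1 [set: 'I_n].
have cl c : closed (edge (bicolored r0 r1 c)) [set: 'I_n] by move=> u v _; rewrite !inE.
have flK c : fl (fl c) = c by exact: flipK (cl c).
have flipb c : properb (fl c) = properb c.
  apply/idP/idP => cP; last exact: flip_proper cP (cl c).
  by rewrite -[c]flK; exact: flip_proper cP (cl _).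
rewrite /des_poly (reindex_onto fl fl); last by move=> c _.
apply: eq_big => [c|c /andP[+ _]]; first by rewrite flipb flK eqxx andbT.
rewrite flipb => cP; rewrite (flip_des r01 cP (cl c)); congr (_ * _)%R.
rewrite (prod_class_size _ (x \o tperm r0 r1)) prod_class_size.
rewrite [RHS](reindex_inj (@perm_inj _ (tperm r0 r1))) /=.
apply: eq_bigr => a _; congr (_ ^+ _)%R.
transitivity #|[set v in [set: 'I_n] | fl c v == a]|.
  by apply: eq_card => v; rewrite !inE.
by rewrite (card_flip (cl c)); apply: eq_card => v; rewrite !inE.
Qed.

Lemma des_poly_perm (s : 'S_k) x : des_poly (x \o s) = des_poly x.
Proof.
have ext x1 x2 : x1 =1 x2 -> des_poly x1 = des_poly x2.
  by move=> xE; apply: eq_bigr => c _; congr (_ * _)%R; exact: eq_bigr.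
have mul (s1 s2 : 'S_k) : (forall x, des_poly (x \o s1) = des_poly x) ->
    (forall x, des_poly (x \o s2) = des_poly x) ->
    forall x, des_poly (x \o (s1 * s2)%g) = des_poly x.
  move=> h1 h2 y; rewrite -(h2 y) -(h1 (y \o s2)).
  by apply: ext => a /=; rewrite permM.
have tp d (i j : 'I_k) : j = i + d.+1 :> nat -> forall x, des_poly (x \o tperm i j) = des_poly x.
  elim: d j => [|d IH] j ij y; first by apply: des_poly_adjacent; rewrite ij addn1.
  have jk : i + d.+1 < k by apply: leq_ltn_trans (ltn_ord j); rewrite ij leq_add2l.
  pose j' := Ordinal jk.
  have adj y' : des_poly (y' \o tperm j' j) = des_poly y'.
    by apply: des_poly_adjacent; rewrite ij /= addnS.
  have -> : tperm i j = (tperm j' j * (tperm i j' * tperm j' j))%g.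
    have := tpermJ i j' (tperm j' j).
    rewrite tpermL tpermD ?conjgE ?tpermV; first by move=> <-.
      by rewrite -val_eqE /=; lia.
    by rewrite -val_eqE /= ij; lia.
  by apply: (mul) => // y'; apply: mul => // z; exact: IH.
have [ts -> _] := prod_tpermP s.
elim: ts x => [|[i j] ts IH] x; first by rewrite big_nil; apply: ext => a /=; rewrite perm1.
rewrite big_cons; apply: mul => {}x //=.
have [h|h|h] := ltngtP i j.
- by apply: (tp (j - i).-1); rewrite prednK ?subn_gt0 // subnKC // ltnW.
- by rewrite tpermC; apply: (tp (i - j).-1); rewrite prednK ?subn_gt0 // subnKC // ltnW.
- by rewrite (val_inj h) tperm1; apply: ext => a /=; rewrite perm1.
Qed.

(** In the determinant term of a permutation [s], symmetry allows the variables of [des_poly] to be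
    permuted by [s] as well; the class sizes then add to the staircase exponents of that same
    term. *)
Lemma alternant_des_poly (y : nat -> R) :
  (alternant y k (fun=> 0%N) * des_poly (fun a : 'I_k => y a) =
  \sum_(c | properb c) t ^+ des c * alternant y k (class_size c))%R.
Proof.
rewrite /alternant /determinant mulr_suml.
under [RHS]eq_bigr do rewrite mulr_sumr.
rewrite [RHS]exchange_big /=; apply: eq_bigr => s _.
rewrite -(des_poly_perm s) mulr_sumr; apply: eq_bigr => c cP.
rewrite prod_class_size mulrCA -!mulrA; congr (_ * (_ * _))%R.
rewrite -big_split /=; apply: eq_bigr => l _.
by rewrite !mxE /= add0n [RHS]exprD mulrC.
Qed.

End Symmetry.

(** * Gasharov's involution *)

Definition rank c v := #|[set u | (c u == c v) && P u v]|.

Definition above_count c v := #|[set u | ((c u).+1 == c v :> nat) && ~~ P v u]|.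

(* In the array whose l-th row lists the colour class l increasingly, [v] sits in column
   [rank c v], and the entries [u] of the row above with [~~ P v u] form an initial segment
   of that row; so a flaw is a violation of the column condition at [v]. *)
Definition flaw c v := (0 < c v) && (above_count c v <= rank c v).

(** The flaw in the leftmost column, and there in the lowest row. The choice of column yields
    [pivot_above_count]. Ties go to the lowest row because the exchange may create a flaw in the
    same column one row higher. *)
Definition pivot c v := flaw c v && [forall y, flaw c y ==>
  ((rank c v < rank c y) || ((rank c v == rank c y) && (c y <= c v)))].

Lemma rank_lt c u v : c u = c v -> P u v -> rank c u < rank c v.
Proof.
move=> cuv Puv; apply/proper_card/properP; split.
  apply/fintype.subsetP => w; rewrite !inE cuv => /andP[-> Pwu] /=.
  exact: (nuio_trans hP Pwu Puv).
by exists u; rewrite !inE ?cuv ?eqxx ?Puv // (nuio_irr hP) andbF.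
Qed.

Lemma pivot_uniq c u v : properb c -> pivot c u -> pivot c v -> u = v.
Proof.
move=> cP /andP[fu /forallP pu] /andP[fv /forallP pv].
have /implyP/(_ fv) := pu v; have /implyP/(_ fu) := pv u => h1 h2.
have [rE cE] : rank c u = rank c v /\ c u = c v.
  by move: h1 h2 => h1 h2; split; [|apply/val_inj => /=]; lia.
have [uv|uv|/val_inj//] := ltngtP u v.
  by have := rank_lt cE (proper_chain cP cE uv); rewrite rE ltnn.
by have := rank_lt (esym cE) (proper_chain cP (esym cE) uv); rewrite rE ltnn.
Qed.

Lemma pivot_exists c v : flaw c v -> exists u, pivot c u.
Proof.
(* The factor [k.+1] exceeds every [k - c y], so minimizing [key] is the lexicographic choice of
   least rank, then largest colour. *)
move=> fv; pose key y := rank c y * k.+1 + (k - c y).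
case: (arg_minnP key fv) => u fu umin; exists u; rewrite /pivot fu.
apply/forallP => y; apply/implyP => /umin; rewrite /key.
have := ltn_ord (c y); have := ltn_ord (c u).
have [//|h|->] := ltngtP (rank c u) (rank c y) => /= h1 h2; last by lia.
suff : rank c y * k.+1 + k.+1 <= rank c u * k.+1 by lia.
by rewrite -mulSnr leq_mul2r h orbT.
Qed.

Lemma rank_pred c v : properb c -> 0 < rank c v ->
  exists u, [/\ c u = c v, P u v & rank c v = (rank c u).+1].
Proof.
move=> cP /card_gt0P[u0]; rewrite inE => u0P.
case: (@arg_maxnP _ u0 (fun u => (c u == c v) && P u v) val u0P) => u /andP[/eqP cu Puv] umax.
exists u; split=> //.
rewrite /rank (cardsD1 u) inE cu eqxx Puv add1n; congr _.+1.
apply: eq_card => w; rewrite !inE; case: (boolP (c w == c v)) => [/eqP cw|]; last by rewrite !andbF.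
have [->|wu] /= := eqVneq w u; first by rewrite (nuio_irr hP).
apply/idP/idP => [Pwv|Pwu]; last exact: (nuio_trans hP Pwu Puv).
apply: (proper_chain cP); first by rewrite cw cu.
by rewrite ltn_neqAle wu /=; apply: umax; rewrite cw eqxx.
Qed.

Definition prev_color (a : 'I_k) : 'I_k :=
  Ordinal (leq_ltn_trans (leq_pred a) (ltn_ord a)).

(** For a pivot [v] of a proper colouring, these are the entries after [v] in its row and those from
    column [rank c v] on in the row above. *)
Definition tail_set c v : {set 'I_n} :=
  [set u in bicolored (prev_color (c v)) (c v) c | P v u].

Definition gasharov c : {ffun 'I_n -> 'I_k} :=
  if [pick v | pivot c v] is Some v
  then flip (prev_color (c v)) (c v) (tail_set c v) c else c.

Section Pivot.
Variables (c : {ffun 'I_n -> 'I_k}) (v : 'I_n).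
Hypotheses (cP : properb c) (pv : pivot c v).
Let r1 := c v.
Let r0 := prev_color r1.
Let U := tail_set c v.
Let c' := flip r0 r1 U c.

Lemma pivot_flaw : flaw c v. Proof. by case/andP: pv. Qed.

Lemma pivot_r01 : r1 = r0.+1 :> nat.
Proof. by case/andP: pivot_flaw => cv0 _; rewrite /= prednK. Qed.

Lemma pivot_no_flaw u : rank c u < rank c v -> ~~ flaw c u.
Proof.
move=> uv; apply/negP => fu; case/andP: pv => _ /forallP/(_ u)/implyP/(_ fu).
by rewrite ltnNge (ltnW uv) /= gtn_eqF.
Qed.

Lemma above_set_sub u : P u v ->
  [set w | ((c w).+1 == c v :> nat) && ~~ P u w] \subset
  [set w | ((c w).+1 == c v :> nat) && ~~ P v w].
Proof.
move=> Puv; apply/fintype.subsetP => w; rewrite !inE => /andP[-> /=].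
by apply: contraNN => Pvw; exact: (nuio_trans hP Puv Pvw).
Qed.

(** With a smaller count, the predecessor of [v] in its row would already be flawed, since its set
    of entries counted above is contained in that of [v]. *)
Lemma pivot_above_count : above_count c v = rank c v.
Proof.
case/andP: pivot_flaw => cv0 le_v; apply/eqP; rewrite eqn_leq le_v leqNgt; apply/negP => lt_v.
have [u [cu Puv rE]] := rank_pred cP (leq_ltn_trans (leq0n _) lt_v).
suff : flaw c u by apply/negP/pivot_no_flaw; rewrite rE.
rewrite /flaw cu cv0 -ltnS -rE; apply: leq_ltn_trans lt_v.
by rewrite /above_count cu; exact/subset_leq_card/above_set_sub.
Qed.

(** For [w <= v], [nuio_mono] lowers [v] to [w] in [P v u]. For [w > v], let [v'] precede [v] in its
    row: [v'] is not flawed, so by cardinality [v'] and [v] have the same entries counted above, and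
    [P v' w] fails; but [P v' v] and [v < w] imply it. *)
Lemma head_below_tail w u : c w = r0 -> ~~ P v w -> c u = r1 -> P v u -> P w u.
Proof.
move=> cw nPvw cu Pvu.
have wA : w \in [set w | ((c w).+1 == c v :> nat) && ~~ P v w].
  by rewrite inE cw nPvw andbT eq_sym; apply/eqP; exact: pivot_r01.
have rv : 0 < rank c v by rewrite -pivot_above_count; apply/card_gt0P; exists w.
have [v' [cv' Pv'v rE]] := rank_pred cP rv.
have nPv'w : ~~ P v' w.
  have : ~~ flaw c v' by apply: pivot_no_flaw; rewrite rE.
  rewrite /flaw cv'; case/andP: pivot_flaw => -> _ /=; rewrite -ltnNge -rE -pivot_above_count.
  rewrite /above_count cv' => le.
  have : [set w0 | ((c w0).+1 == c v :> nat) && ~~ P v' w0] =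
         [set w0 | ((c w0).+1 == c v :> nat) && ~~ P v w0].
    by apply/eqP; rewrite eqEcard above_set_sub.
  by move/setP/(_ w); rewrite wA inE => /andP[].
case: (leqP w v) => wv; first exact: (nuio_mono hP Pvu wv (leqnn _)).
by case/negP: nPv'w; exact: (nuio_mono hP Pv'v (leqnn _) (ltnW wv)).
Qed.

Lemma tail_head w u : w \notin U -> c w = r0 -> u \in U -> P w u.
Proof.
rewrite !inE => + cw; rewrite cw eqxx /= => nPvw /andP[/orP[]/eqP cu Pvu].
  have cwu : c w = c u by rewrite cw cu.
  have [wu|wu|wu] := ltngtP w u; first exact: proper_chain cP cwu wu.
    by case/negP: nPvw; exact: (nuio_trans hP Pvu (proper_chain cP (esym cwu) wu)).
  by case/negP: nPvw; rewrite (val_inj wu).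
exact: head_below_tail.
Qed.

Lemma head_pivot w : w \notin U -> c w = r1 -> w = v \/ P w v.
Proof.
rewrite !inE => + cw; rewrite cw eqxx orbT /= => nPvw.
have [wv|wv|wv] := ltngtP w v; last by left; exact: val_inj.
  by right; exact: proper_chain cP cw wv.
by case/negP: nPvw; exact: proper_chain cP (esym cw) wv.
Qed.

Lemma tailP u : u \in U -> P v u.
Proof. by rewrite inE => /andP[]. Qed.

Lemma head_pivot_tail w u : w \notin U -> c w = r1 -> u \in U -> P w u.
Proof.
move=> wU cw /tailP Pvu; case: (head_pivot wU cw) => [->//|Pwv].
exact: (nuio_trans hP Pwv Pvu).
Qed.

(** Every head entry of either row is below every tail entry, so no edge joins the two. *)
Lemma tail_closed : closed (edge (bicolored r0 r1 c)) U.
Proof.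
apply: (intro_closed (@edge_connect_sym _)) => u w /and3P[uW wW uw] uU.
apply: contraT => wU; move: (wW); rewrite inE => /orP[]/eqP cw.
  by move: uw; rewrite incomp_sym incompF // (tail_head wU cw uU).
by move: uw; rewrite incomp_sym incompF // (head_pivot_tail wU cw uU).
Qed.

Lemma flip_notin u : u \notin U -> c' u = c u.
Proof. by move=> /negPf uU; rewrite ffunE uU. Qed.

Lemma flip_in u : u \in U -> c' u = r0 \/ c' u = r1.
Proof.
move=> uU; have : u \in bicolored r0 r1 c' by rewrite bicolored_flip; move: uU; rewrite inE => /andP[].
by rewrite inE => /orP[]/eqP; tauto.
Qed.

Lemma color_in u : u \in U -> c u = r0 \/ c u = r1.
Proof. by rewrite !inE => /andP[/orP[]/eqP]; tauto. Qed.

Lemma card_head0 : #|[set u in ~: U | c u == r0]| = rank c v.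
Proof.
rewrite -pivot_above_count; apply: eq_card => u; rewrite !inE -/r1 -/r0.
case: (boolP (c u == r0)) => [/eqP->|cu]; rewrite ?andbF ?andbT.
  by rewrite -pivot_r01 eqxx.
by rewrite pivot_r01 eqSS val_eqE (negPf cu).
Qed.

Lemma card_head1 : #|[set u in ~: U | c u == r1]| = (rank c v).+1.
Proof.
have vU : v \notin U by rewrite inE (nuio_irr hP) andbF.
rewrite (cardsD1 v) 2!inE vU eqxx add1n; congr _.+1.
apply: eq_card => u; rewrite finset.in_setD1 [in RHS]inE [in X in _ && X]inE finset.in_setC.
apply/idP/idP => [/and3P[uv uU /eqP cu]|/andP[/eqP cu Puv]].
  by have [uE|->] := head_pivot uU cu; [rewrite uE eqxx in uv | rewrite cu eqxx].
apply/and3P; split; last by rewrite cu.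
  by apply: contraTN Puv => /eqP->; rewrite (nuio_irr hP).
by apply: contraTN Puv => /tailP Pvu; apply/negP => /(nuio_trans hP Pvu); rewrite (nuio_irr hP).
Qed.

Lemma class_size_split (d : {ffun 'I_n -> 'I_k}) (a : 'I_k) :
  class_size d a = #|[set u in U | d u == a]| + #|[set u in ~: U | d u == a]|.
Proof.
rewrite /class_size -[LHS](cardsID U); congr (_ + _); apply: eq_card => u;
  by rewrite !inE ?val_eqE andbC.
Qed.

Lemma card_head_flip a : #|[set u in ~: U | c' u == a]| = #|[set u in ~: U | c u == a]|.
Proof.
apply: eq_card => u; rewrite [in LHS]inE [in RHS]inE !finset.in_setC.
by case: (boolP (u \in U)) => //= uU; rewrite flip_notin.
Qed.

(** The heads have lengths [rank c v] and [(rank c v).+1], and the tails trade their sizes. The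
    difference of one is the step of the staircase exponents, so the alternant has two rows
    swapped. *)
Lemma class_size_flip0 : (class_size c' r0).+1 = class_size c r1.
Proof.
rewrite !class_size_split card_head_flip card_head0 card_head1 addnS.
by rewrite (card_flip tail_closed) tpermL.
Qed.

Lemma class_size_flip1 : class_size c' r1 = (class_size c r0).+1.
Proof.
rewrite !class_size_split card_head_flip card_head0 card_head1 addnS.
by rewrite (card_flip tail_closed) tpermR.
Qed.

Lemma class_size_flip_other (a : 'I_k) : a != r0 -> a != r1 ->
  class_size c' a = class_size c a.
Proof.
move=> a0 a1; rewrite !class_size_split card_head_flip (card_flip tail_closed).
by rewrite tpermD // eq_sym.
Qed.

(** If a tail element is below [y], then so is [v]; as [y] is outside the tail, its colour is
    neither [r0] nor [r1]. *)
Lemma rank_flip y : y \notin U -> rank c' y = rank c y.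
Proof.
move=> yU; rewrite /rank (flip_notin yU); apply: eq_card => u; rewrite !inE.
case: (boolP (P u y)) => Puy; rewrite ?andbF // !andbT.
case: (boolP (u \in U)) => uU; last by rewrite flip_notin.
have Pvy : P v y := nuio_trans hP (tailP uU) Puy.
have yW : (c y != r0) && (c y != r1).
  by move: yU; rewrite !inE Pvy andbT negb_or.
case/andP: yW => y0 y1.
have -> : (c' u == c y) = false.
  by case: (flip_in uU) => ->; rewrite eq_sym (negPf y0, negPf y1).
by case: (color_in uU) => ->; rewrite eq_sym (negPf y0, negPf y1).
Qed.

Lemma rank_flip_in0 y : y \in U -> c' y = r0 -> rank c v <= rank c' y.
Proof.
move=> yU cy; rewrite -card_head0; apply/subset_leq_card/fintype.subsetP => u.
rewrite 2!inE => /andP[uU /eqP cu]; rewrite inE cy flip_notin // cu eqxx.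
exact: tail_head.
Qed.

Lemma rank_flip_in1 y : y \in U -> c' y = r1 -> rank c v < rank c' y.
Proof.
move=> yU cy; rewrite -card_head1; apply/subset_leq_card/fintype.subsetP => u.
rewrite 2!inE => /andP[uU /eqP cu]; rewrite inE cy flip_notin // cu eqxx.
exact: head_pivot_tail.
Qed.

Lemma pivot_notin : v \notin U.
Proof. by rewrite inE (nuio_irr hP) andbF. Qed.

Lemma above_count_flip y : y \notin U -> (forall u, u \in U -> P y u) ->
  above_count c' y = above_count c y.
Proof.
move=> yU yP; rewrite /above_count (flip_notin yU); apply: eq_card => u; rewrite !inE.
case: (boolP (u \in U)) => uU; last by rewrite flip_notin.
by rewrite yP // !andbF.
Qed.

(** The row above [y] changes only when [y] has colour [r1] or [r1 + 1]. In the first case [y] is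
    below the whole tail, which therefore is never counted. In the second, either [y] is below a
    head entry of [r1], hence below the tail, or all [(rank c v).+1] head entries are counted, too
    many for a flaw at this rank. *)
Lemma flaw_flip y : y \notin U -> rank c y <= rank c v -> flaw c' y -> flaw c y.
Proof.
move=> yU yv; rewrite /flaw (flip_notin yU) rank_flip // => /andP[cy0 ley].
rewrite cy0 /=; have [cy|ncy] := eqVneq (c y) r1.
  by rewrite -above_count_flip // => u; exact: head_pivot_tail.
have [cy|ncy2] := eqVneq (c y : nat) r1.+1; last first.
  suff <- : above_count c' y = above_count c y by [].
  rewrite /above_count (flip_notin yU); apply: eq_card => u; rewrite !inE.
  case: (boolP (u \in U)) => uU; last by rewrite flip_notin.
  have h (a : 'I_k) : a = r0 \/ a = r1 -> (a.+1 == c y :> nat) = false.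
    case=> ->; last by rewrite eq_sym (negPf ncy2).
    by rewrite -pivot_r01 eq_sym val_eqE (negPf ncy).
  by rewrite (h _ (flip_in uU)) (h _ (color_in uU)).
case: (boolP [exists w, [&& w \notin U, c w == r1 & P y w]]) => [/existsP[w /and3P[wU /eqP cw Pyw]]|].
  rewrite -above_count_flip // => u uU.
  exact: (nuio_trans hP Pyw (head_pivot_tail wU cw uU)).
rewrite negb_exists => /forallP noP.
have : (rank c v).+1 <= above_count c' y.
  rewrite -card_head1; apply/subset_leq_card/fintype.subsetP => u.
  rewrite 2!inE => /andP[uU /eqP cu]; rewrite inE flip_notin // flip_notin // cu cy eqxx /=.
  by have := noP u; rewrite uU cu eqxx.
by move=> h; have := leq_trans h (leq_trans ley yv); rewrite ltnn.
Qed.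

(** Finding the same pivot again makes the exchange an involution. Tail elements have new rank at
    least [rank c v], with equality only for colour [r0], which loses the tie. *)
Lemma pivot_flip : pivot c' v.
Proof.
have cv := flip_notin pivot_notin; have rv := rank_flip pivot_notin.
apply/andP; split.
  rewrite /flaw cv rv above_count_flip; [exact: pivot_flaw | exact: pivot_notin | exact: tailP].
apply/forallP => y; apply/implyP => fy; rewrite rv cv.
case: (boolP (y \in U)) => yU.
  case: (flip_in yU) => cy; last by rewrite rank_flip_in1.
  have := rank_flip_in0 yU cy; rewrite leq_eqVlt => /orP[/eqP rE|->//].
  by rewrite rE eqxx cy -/r1 pivot_r01 leqnSn orbT.
rewrite rank_flip // flip_notin //; case: (ltnP (rank c v) (rank c y)) => //= le_y.
have fcy := flaw_flip yU le_y fy.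
case/andP: pv => _ /forallP/(_ y)/implyP/(_ fcy).
by rewrite ltnNge le_y.
Qed.

End Pivot.

Definition flawed c := [exists v, flaw c v].

Lemma gasharovE c v : properb c -> pivot c v ->
  gasharov c = flip (prev_color (c v)) (c v) (tail_set c v) c.
Proof.
move=> cP pv; rewrite /gasharov; case: pickP => [u pu|/(_ v)]; last by rewrite pv.
by rewrite (pivot_uniq cP pu pv).
Qed.

Lemma flawedP c : flawed c -> exists v, pivot c v.
Proof. by case/existsP => v; exact: pivot_exists. Qed.

Lemma gasharov_proper c : properb c -> flawed c -> properb (gasharov c).
Proof.
move=> cP /flawedP[v pv]; rewrite (gasharovE cP pv).
exact: flip_proper cP (tail_closed cP pv).
Qed.

Lemma gasharov_flawed c : properb c -> flawed c -> flawed (gasharov c).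
Proof.
move=> cP /flawedP[v pv]; rewrite (gasharovE cP pv).
by apply/existsP; exists v; have /andP[] := pivot_flip cP pv.
Qed.

Lemma gasharov_des c : properb c -> flawed c -> des (gasharov c) = des c.
Proof.
move=> cP /flawedP[v pv]; rewrite (gasharovE cP pv).
exact: (@flip_des (prev_color (c v)) (c v) (pivot_r01 pv) c _ cP (tail_closed cP pv)).
Qed.

Lemma gasharovK c : properb c -> flawed c -> gasharov (gasharov c) = c.
Proof.
move=> cP cF; have [v pv] := flawedP cF.
have c'P := gasharov_proper cP cF; have pv' := pivot_flip cP pv.
rewrite -(gasharovE cP pv) in pv'.
rewrite (gasharovE c'P pv').
have cv : gasharov c v = c v by rewrite (gasharovE cP pv) flip_notin // pivot_notin.
rewrite cv /tail_set cv (gasharovE cP pv) bicolored_flip.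
exact: flipK (tail_closed cP pv).
Qed.

Lemma gasharov_alternant (R : comNzRingType) (y : nat -> R) c : properb c -> flawed c ->
  (alternant y k (class_size (gasharov c)) = - alternant y k (class_size c))%R.
Proof.
move=> cP /flawedP[v pv]; rewrite (gasharovE cP pv).
have r01 := pivot_r01 pv.
apply: (@alternant_swap _ _ _ (prev_color (c v)) (c v)); first exact: r0_neq_r1.
move=> l; have ck := ltn_ord (c v).
case: tpermP => [->|->|/eqP l0 /eqP l1].
- by move: (class_size_flip0 cP pv) r01 ck => /=; lia.
- by move: (class_size_flip1 cP pv) r01 ck => /=; lia.
- by rewrite (class_size_flip_other cP pv).
Qed.

(** The involution fixes a colouring whose tail has only balanced components; deducing [S = - S] and
    dividing by two covers these fixed points too. *)
Lemma flawed_sum0 (R : comNzRingType) (t : R) (y : nat -> R) :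
  (forall z : R, z + z = 0 -> z = 0)%R ->
  (\sum_(c | properb c && flawed c) t ^+ des c * alternant y k (class_size c) = 0)%R.
Proof.
move=> R2; set S := (\sum_(c | _) _)%R; apply: R2.
suff {2}-> : S = (- S)%R by rewrite subrr.
rewrite {1}/S (reindex_onto gasharov gasharov) => [|c /andP[cP cF]]; last exact: gasharovK.
rewrite -sumrN; apply: eq_big => [c|c /andP[/andP[gP gF] /eqP gg]].
  apply/idP/idP => [/andP[/andP[gP gF] /eqP gg]|/andP[cP cF]].
    by rewrite -gg; apply/andP; split; [exact: gasharov_proper | exact: gasharov_flawed].
  by rewrite gasharov_proper ?gasharov_flawed ?gasharovK ?eqxx.
have cP : properb c by rewrite -gg gasharov_proper.
have cF : flawed c by rewrite -gg gasharov_flawed.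
by rewrite gasharov_des // gasharov_alternant // mulrN.
Qed.

Lemma alternant_des_poly_flawless (R : comNzRingType) (t : R) (y : nat -> R) :
  (forall z : R, z + z = 0 -> z = 0)%R ->
  (alternant y k (fun=> 0%N) * des_poly t (fun a : 'I_k => y a) =
   \sum_(c | properb c && ~~ flawed c) t ^+ des c * alternant y k (class_size c))%R.
Proof.
move=> R2; by rewrite alternant_des_poly (bigID flawed) /= flawed_sum0 // add0r.
Qed.

(** * Flawless colourings and P-tableaux *)

Section ColoringTableau.

Definition color_row c (l : nat) : seq 'I_n := [seq v <- enum 'I_n | c v == l :> nat].

Definition color_tableau c : seq (seq 'I_n) :=
  [seq r <- mkseq (color_row c) k | r != [::]].

Lemma mem_color_row c l v : (v \in color_row c l) = (c v == l :> nat).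
Proof. by rewrite mem_filter mem_enum andbT. Qed.

Lemma size_color_row c l : size (color_row c l) = class_size c l.
Proof.
rewrite size_filter -sum1_count big_enum_cond sum1_card.
by apply: eq_card => v; rewrite !inE.
Qed.

Lemma color_row_uniq c l : uniq (color_row c l).
Proof. exact/filter_uniq/enum_uniq. Qed.

Lemma color_row_sorted c l : sorted (fun u v : 'I_n => u < v) (color_row c l).
Proof.
apply: sorted_filter; first by move=> x y z; exact: ltn_trans.
rewrite (@eq_sorted _ _ (relpre val ltn)) // -sorted_map val_enum_ord.
exact: iota_ltn_sorted.
Qed.

Lemma color_row_P c l : properb c -> sorted P (color_row c l).
Proof.
move=> cP; case E: (color_row c l) => [|v0 s0]; first by [].
rewrite -E; apply/(sortedP v0) => i il.
have h1 := mem_nth v0 (ltnW il); have h2 := mem_nth v0 il.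
apply: (proper_chain cP).
  by apply/val_inj => /=; move: h1 h2; rewrite !mem_color_row => /eqP-> /eqP->.
exact: (sortedP v0 (color_row_sorted c l)).
Qed.

Lemma sorted_P_nth (s : seq 'I_n) v0 i j : sorted P s ->
  i < j -> j < size s -> P (nth v0 s i) (nth v0 s j).
Proof.
move=> sP ij js; apply: (sorted_ltn_nth (@nuio_trans _ _ hP)) => //.
by rewrite inE (ltn_trans ij).
Qed.

(** With nonincreasing class sizes the empty rows all come last, so deleting them shifts no row
    index. *)
Lemma row_color_tableau c :
    (forall l, class_size c l.+1 <= class_size c l) ->
  forall l, row_of (color_tableau c) l = color_row c l.
Proof.
move=> dec l; have padE (s : seq (seq 'I_n)) :
    (forall i, size (row_of s i.+1) <= size (row_of s i)) ->
    forall i, row_of [seq r <- s | r != [::]] i = row_of s i.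
  elim: s => [|r s IH] //= sdec; case: eqP => [r0|_] /=; last first.
    by case=> // i; apply: IH => j; exact: (sdec j.+1).
  have s0 i : size (row_of s i) = 0.
    elim: i => [|i IHi]; apply/eqP; rewrite -leqn0.
      by have := sdec 0; rewrite r0.
    by rewrite -IHi; exact: (sdec i.+1).
  have -> : [seq r <- s | r != [::]] = [::].
    apply/eqP; rewrite -[_ == _]negbK -has_filter; apply/hasPn => q.
    move=> /(nthP [::])[i _ <-]; rewrite negbK -size_eq0.
    by rewrite -/(row_of s i) s0.
  move=> i; rewrite [LHS]nth_nil; case: i => [|i]; first by rewrite r0.
  by apply/esym/size0nil; exact: s0.
have mkE i : row_of (mkseq (color_row c) k) i = color_row c i.
  case: (ltnP i k) => ik; first by rewrite /row_of nth_mkseq.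
  rewrite /row_of nth_default ?size_mkseq //; apply/esym/size0nil/eqP.
  rewrite size_filter -leqn0 leqNgt -has_count; apply/hasPn => v _.
  by rewrite ltn_eqF // (leq_trans (ltn_ord _)).
by rewrite padE // => i; rewrite !mkE !size_color_row.
Qed.

Lemma rank_nth c l v0 j : properb c -> j < size (color_row c l) ->
  rank c (nth v0 (color_row c l) j) = j.
Proof.
move=> cP jl; set y := nth _ _ _.
have cy : c y = l :> nat by apply/eqP; rewrite -mem_color_row mem_nth.
rewrite -[RHS](size_takel (ltnW jl)).
have /card_uniqP <- : uniq (take j (color_row c l)) by rewrite take_uniq ?color_row_uniq.
apply: eq_card => u; rewrite inE; apply/andP/idP => [[/eqP cu Puy]|].
  have ul : u \in color_row c l by rewrite mem_color_row cu cy.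
  rewrite in_take //; rewrite ltnNge; apply/negP => ju.
  have ui : index u (color_row c l) < size (color_row c l) by rewrite index_mem.
  have uE := nth_index v0 ul.
  move: ju; rewrite leq_eqVlt => /orP[/eqP jE|ju].
    by move: Puy; rewrite /y jE uE (nuio_irr hP).
  have := sorted_P_nth v0 (color_row_P l cP) ju ui; rewrite uE => Pyu.
  by have := nuio_trans hP Puy Pyu; rewrite (nuio_irr hP).
move=> ut; have ul := mem_take ut; split.
  by apply/eqP/val_inj; rewrite /= cy; apply/eqP; rewrite -mem_color_row.
rewrite -(nth_index v0 ul); apply: sorted_P_nth => //; first exact: color_row_P.
by rewrite -in_take.
Qed.

Section Flawless.
Variable c : {ffun 'I_n -> 'I_k}.
Hypotheses (cP : properb c) (cF : ~~ flawed c).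

Lemma flawless_rank v : 0 < c v -> rank c v < above_count c v.
Proof.
move=> cv; move: cF; rewrite negb_exists => /forallP/(_ v).
by rewrite /flaw cv /= -ltnNge.
Qed.

Lemma flawless_class_size l : class_size c l.+1 <= class_size c l.
Proof.
rewrite leqNgt; apply/negP => lt_l.
rewrite -!size_color_row in lt_l.
have [v0 _] : exists v0 : 'I_n, true.
  by case: (color_row c l.+1) lt_l => // v0 *; exists v0.
(* [y] is the first entry of row [l + 1] beyond the end of row [l]; its rank is the size of row [l],
   which bounds [above_count]. *)
have ry := rank_nth v0 cP lt_l; set y := nth v0 _ _ in ry.
have cy : c y = l.+1 :> nat by apply/eqP; rewrite -mem_color_row mem_nth.
have := @flawless_rank y; rewrite cy ry => /(_ isT).
rewrite ltnNge => /negP; apply; rewrite size_color_row.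
by apply/subset_leq_card/fintype.subsetP => u; rewrite !inE cy eqSS => /andP[].
Qed.

Lemma row_flawless l : row_of (color_tableau c) l = color_row c l.
Proof. exact: row_color_tableau flawless_class_size l. Qed.

Lemma shape_flawless l : nth 0 (shape (color_tableau c)) l = class_size c l.
Proof. by rewrite nth_shape -/(row_of _ _) row_flawless size_color_row. Qed.

Lemma color_tableau_perm : perm_eq (flatten (color_tableau c)) (enum 'I_n).
Proof.
have -> : flatten (color_tableau c) = flatten (mkseq (color_row c) k).
  rewrite /color_tableau; elim: (mkseq _ _) => //= r s <-.
  by case: eqP => [->|].
apply/seq.permP => a; rewrite count_flatten -map_comp sumnE big_map.
rewrite -{1}[k]subn0 -/(index_iota 0 k) big_mkord -[RHS]sum1_count.
rewrite (partition_big c predT) //=; apply: eq_bigr => l _.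
rewrite count_filter -sum1_count; apply: eq_bigl => v /=.
by rewrite val_eqE.
Qed.

Lemma color_tableau_is_tableau : P_tableaux P (color_tableau c).
Proof.
split; last exact: color_tableau_perm.
split.
- apply/andP; split.
    by apply/(sortedP 0) => i _; rewrite /geq /= !shape_flawless flawless_class_size.
  by apply/mapP => -[r]; rewrite mem_filter => /andP[r0 _] /esym/size0nil rE; rewrite rE in r0.
- move=> i j x y /(entry_Some x)[_ <-] /(entry_Some x)[ji <-].
  by move: ji; rewrite row_flawless => ji; apply: sorted_P_nth => //; exact: color_row_P.
- move=> i j x y /(entry_Some x)[jx xE] /(entry_Some x)[jy yE].
  move: jx xE jy yE; rewrite !row_flawless => jx xE jy yE.
  apply/negP => Pyx.
  have cy : c y = i.+1 :> nat by apply/eqP; rewrite -mem_color_row -yE mem_nth.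
  (* Given [P y x], all entries of row [i] from column [j] on are above [y], so at most [j] of them
     are counted: a flaw at [y]. *)
  have := @flawless_rank y; rewrite cy -{1}yE rank_nth // => /(_ isT).
  rewrite ltnNge => /negP; apply.
  rewrite -[X in _ <= X](size_takel (ltnW jx)).
  have /card_uniqP <- : uniq (take j (color_row c i)) by rewrite take_uniq ?color_row_uniq.
  apply/subset_leq_card/fintype.subsetP => u; rewrite inE cy eqSS => /andP[cu nPyu].
  have ui : u \in color_row c i by rewrite mem_color_row.
  rewrite in_take // ltnNge; apply: contraNN nPyu.
  rewrite leq_eqVlt => /orP[/eqP jE|ju].
    by rewrite -(nth_index x ui) -jE xE.
  apply: (nuio_trans hP Pyx); rewrite -xE -(nth_index x ui).
  by apply: sorted_P_nth; rewrite ?color_row_P ?index_mem.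
Qed.

Lemma row_index_color_tableau v : row_index (color_tableau c) v = c v.
Proof.
have memE l : (v \in row_of (color_tableau c) l) = (c v == l :> nat).
  by rewrite row_flawless mem_color_row.
have hv : has (fun r => v \in r) (color_tableau c).
  have := mem_enum 'I_n v; rewrite -(perm_mem color_tableau_perm) => /flattenP[r rT vr].
  by apply/hasP; exists r.
by have := nth_find [::] hv; rewrite -/(row_index _ _) -/(row_of _ _) memE => /eqP.
Qed.

Lemma tab_inv_color_tableau : tab_inv (incomp P) (color_tableau c) = des c.
Proof. by apply: eq_card => p; rewrite !inE !row_index_color_tableau. Qed.

End Flawless.

(** * From tableaux back to flawless colourings *)

Section TableauColoring.
Hypothesis nk : n <= k.
Variable T : seq (seq 'I_n).
Hypothesis TP : P_tableaux P T.

(** The default [widen_ord nk v] is never taken: the rows of [T] are nonempty, so there are at most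
    [n <= k] of them. *)
Definition tableau_coloring : {ffun 'I_n -> 'I_k} :=
  [ffun v => insubd (widen_ord nk v) (row_index T v)].

Let c := tableau_coloring.

Lemma tab_flatten_uniq : uniq (flatten T).
Proof. by case: TP => _ /perm_uniq->; exact: enum_uniq. Qed.

Lemma tab_size_row l : size (row_of T l.+1) <= size (row_of T l).
Proof.
case: TP => [[/is_partition_nonincr/(_ l) h _ _] _].
by rewrite !nth_shape in h.
Qed.

Lemma tab_row_neq0 r : r \in T -> r != [::].
Proof.
case: TP => [[/andP[_ s0] _ _] _] rT; apply: contraNN s0 => /eqP r0.
by apply/mapP; exists r => //; rewrite r0.
Qed.

Lemma tab_size_le : size T <= n.
Proof.
case: TP => _ /perm_size; rewrite size_enum_ord => {2}<-.
have := tab_row_neq0; elim: (T) => //= r s IH nz.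
rewrite size_cat -add1n leq_add ?IH // => [|q qs]; last by apply: nz; rewrite inE qs orbT.
by rewrite lt0n size_eq0 nz ?mem_head.
Qed.

Lemma row_indexE v l : (v \in row_of T l) = (row_index T v == l).
Proof.
have vT : v \in flatten T by case: TP => _ /perm_mem->; rewrite mem_enum.
have := tab_flatten_uniq; move: vT l; rewrite /row_index; elim: (T) => //= r s IH.
rewrite mem_cat cat_uniq => vT l /and3P[_ /hasPn rs us].
case: (boolP (v \in r)) vT => [vr _|vr /= vs].
  case: l => [|l]; first by rewrite /row_of /= vr.
  rewrite /row_of /=; apply/negbTE/negP => vl.
  suff /rs : v \in flatten s by rewrite vr.
  apply/flattenP; exists (nth [::] s l) => //; apply: mem_nth; rewrite ltnNge; apply/negP => h.
  by rewrite nth_default in vl.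
by case: l => [|l]; rewrite /row_of /= ?(negPf vr) // eqSS -IH.
Qed.

Lemma tableau_coloringE v : c v = row_index T v :> nat.
Proof.
rewrite ffunE val_insubd (_ : _ < k) //.
apply: leq_trans nk; apply: leq_trans tab_size_le.
have vT : v \in flatten T by case: TP => _ /perm_mem->; rewrite mem_enum.
by rewrite -has_find; apply/hasP; case/flattenP: vT => r; exists r.
Qed.

Lemma mem_tab_row v l : (v \in row_of T l) = (c v == l :> nat).
Proof. by rewrite row_indexE tableau_coloringE. Qed.

Lemma tab_row_sorted l : sorted P (row_of T l).
Proof.
case E: (row_of T l) => [|v0 s0] //; rewrite -E; apply/(sortedP v0) => i il.
case: TP => [[_ Tr _] _]; apply: (Tr l i); apply/(entry_Some v0); split=> //; exact: ltnW.
Qed.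

Lemma tab_row_color_row l : row_of T l = color_row c l.
Proof.
apply: (@irr_sorted_eq _ (fun u v : 'I_n => u < v)).
- by move=> x y z; exact: ltn_trans.
- by move=> x; exact: ltnn.
- by apply: sub_sorted (tab_row_sorted l) => u v; exact: nuio_natural.
- exact: color_row_sorted.
- by move=> v; rewrite mem_tab_row mem_color_row.
Qed.

Lemma tableau_coloring_proper : properb c.
Proof.
apply/forallP => u; apply/forallP => v; apply/implyP => uv; apply/negP => /eqP cuv.
have ul : u \in row_of T (c u) by rewrite mem_tab_row.
have vl : v \in row_of T (c u) by rewrite mem_tab_row cuv.
have neq : index u (row_of T (c u)) != index v (row_of T (c u)).
  apply: contraTneq uv => iE; have -> : u = v by rewrite -(nth_index u ul) iE nth_index.
  by rewrite /incomp eqxx.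
move: uv; rewrite -(nth_index u ul) -[in X in incomp P _ X](nth_index u vl).
move: neq; rewrite neq_ltn => /orP[] h; last rewrite incomp_sym;
  by rewrite incompF // sorted_P_nth ?tab_row_sorted ?index_mem.
Qed.

Lemma tableau_coloring_flawless : ~~ flawed c.
Proof.
have cP := tableau_coloring_proper.
apply/negP => /existsP[v /andP[cv0]]; rewrite leqNgt => /negP; apply.
case cvE: (c v : nat) cv0 => [//|l] _.
have vl : v \in color_row c l.+1 by rewrite mem_color_row cvE.
set j := index v (color_row c l.+1).
have jl : j < size (color_row c l.+1) by rewrite index_mem.
have -> : rank c v = j by rewrite -{1}(nth_index v vl) rank_nth.
have jl' : j < size (color_row c l).
  by apply: leq_trans jl _; rewrite -!tab_row_color_row tab_size_row.
rewrite -[X in X <= _](size_takel jl').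
have /card_uniqP <- : uniq (take j.+1 (color_row c l)) by rewrite take_uniq ?color_row_uniq.
apply/subset_leq_card/fintype.subsetP => u ut; have ul := mem_take ut.
rewrite inE; move: (ul); rewrite mem_color_row => /eqP->; rewrite cvE eqxx /=.
apply/negP => Pvu.
have nP : ~~ P v (nth v (color_row c l) j).
  case: TP => [[_ _ Tc] _]; apply: (Tc l j); apply/(entry_Some v); rewrite tab_row_color_row //.
  by split=> //; exact: nth_index.
case/negP: nP; move: ut; rewrite in_take // ltnS leq_eqVlt => /orP[/eqP <-|uj].
  by rewrite nth_index.
apply: (nuio_trans hP Pvu); rewrite -{1}(nth_index v ul).
by apply: sorted_P_nth => //; exact: color_row_P.
Qed.

Lemma tableau_coloringK : color_tableau c = T.
Proof.
have -> : color_tableau c = [seq r <- T ++ nseq (k - size T) [::] | r != [::]].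
  congr filter; apply: (@eq_from_nth _ [::]).
    by rewrite size_mkseq size_cat size_nseq subnKC // (leq_trans tab_size_le).
  move=> i; rewrite size_mkseq => ik; rewrite nth_mkseq //.
  by rewrite -/(row_of _ _) row_pad tab_row_color_row.
rewrite filter_cat filter_nseq cats0; apply/all_filterP/allP => r; exact: tab_row_neq0.
Qed.

End TableauColoring.

Lemma sum_tableaux (V : nmodType) (h : seq (seq 'I_n) -> V) : n <= k ->
  (\sum_(T \in P_tableaux P) h T =
   \sum_(c | properb c && ~~ flawed c) h (color_tableau c))%R.
Proof.
move=> nk.
pose L := [seq color_tableau c | c <- enum [pred c | properb c && ~~ flawed c]].
have LU : uniq L.
  rewrite map_inj_in_uniq ?enum_uniq // => c d; rewrite !mem_enum !inE.
  move=> /andP[cP cF] /andP[dP dF] cd; apply/ffunP => v; apply: val_inj.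
  by rewrite /= -(row_index_color_tableau cP cF) cd row_index_color_tableau.
have -> : P_tableaux P = [set` L]%classic.
  apply/seteqP; split=> T /=.
    move=> TP; apply/mapP; exists (tableau_coloring nk T); last by rewrite tableau_coloringK.
    by rewrite mem_enum inE tableau_coloring_proper // tableau_coloring_flawless.
  case/mapP => c; rewrite mem_enum inE => /andP[cP cF] ->.
  exact: color_tableau_is_tableau.
by rewrite -fsbig_seq // big_map big_enum.
Qed.

End ColoringTableau.

End Colorings.

(** * Comparison of coefficients *)

Lemma bounded_ssyts_nil k : bounded_ssyts k [::] = [:: [::]].
Proof.
have E T : (T \in bounded_ssyts k [::]) = (T \in [:: [::]]).
  rewrite inE; apply/idP/eqP => [/mem_bounded_ssyts[]// _ /eqP|->].
    by rewrite -size_eq0 size_map size_eq0 => /eqP.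
  apply/mem_bounded_ssyts => //; split=> //; split=> // i j x y; rewrite /entry nth_nil onth0n //.
apply: perm_small_eq => //; apply: uniq_perm => //; exact: bounded_ssyts_uniq.
Qed.

Lemma alternant0 (R : comNzRingType) (x : nat -> R) k :
  alternant x k (fun=> 0) = vandermonde x k.
Proof.
rewrite -[RHS]mulr1.
have -> : (1 = \sum_(T <- bounded_ssyts k [::]) \prod_(e <- flatten T) x e)%R.
  by rewrite bounded_ssyts_nil big_seq1 big_nil.
rewrite -(@alternant_partition R x k [::]) //.
by congr (\det _)%R; apply/matrixP => l i; rewrite !mxE nth_nil.
Qed.

Section ColoringPolynomial.
Variables (n k : nat) (P : rel 'I_n).
Hypotheses (hP : natural_unit_interval_order P) (nk : (n <= k)%N).
Variables (R : comNzRingType) (t : R) (x : nat -> R).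
Hypothesis R2 : (forall z : R, z + z = 0 -> z = 0)%R.
Local Open Scope ring_scope.

Definition nat_coloring (c : {ffun 'I_n -> 'I_k}) : {ffun 'I_n -> nat} :=
  [ffun v => val (c v)].

(** Reversing the colours turns ascents into descents and reverses the variables, which
    [des_poly_perm] undoes. *)
Lemma asc_poly_des_poly :
  \sum_(c : {ffun 'I_n -> 'I_k} | properb P c)
     t ^+ asc (incomp P) (nat_coloring c) * \prod_v x (c v) =
  des_poly P t (fun a : 'I_k => x a).
Proof.
rewrite -(des_poly_perm hP t (perm (@rev_ord_inj k))).
pose rv (c : {ffun 'I_n -> 'I_k}) : {ffun 'I_n -> 'I_k} := [ffun v => rev_ord (c v)].
have rvK : involutive rv by move=> c; apply/ffunP => v; rewrite !ffunE rev_ordK.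
rewrite /des_poly [RHS](reindex_inj (inv_inj rvK)) /=.
apply: eq_big => [c|c cP].
  apply: eq_forallb => u; apply: eq_forallb => v; rewrite !ffunE.
  by rewrite (inj_eq (@rev_ord_inj k)).
congr (_ ^+ _ * _); last by apply: eq_bigr => v _; rewrite permE ffunE rev_ordK.
apply: eq_card => p; rewrite !inE !ffunE /=.
have := ltn_ord (c p.1); have := ltn_ord (c p.2) => h1 h2.
congr [&& _, _ & _]; move: (val (c p.1)) (val (c p.2)) h1 h2 => /= a b; lia.
Qed.

Lemma vandermonde_asc_poly :
  vandermonde x k * (\sum_(c : {ffun 'I_n -> 'I_k} | properb P c)
     t ^+ asc (incomp P) (nat_coloring c) * \prod_v x (c v)) =
  vandermonde x k * (\sum_(c : {ffun 'I_n -> 'I_k} | properb P c && ~~ flawed P c)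
     t ^+ des P c * \sum_(S <- bounded_ssyts k (shape (color_tableau c)))
       \prod_(e <- flatten S) x e).
Proof.
rewrite asc_poly_des_poly -alternant0 alternant_des_poly_flawless // mulr_sumr.
apply: eq_bigr => c /andP[cP cF]; rewrite mulrCA alternant0; congr (_ * _).
have TP := color_tableau_is_tableau hP cP cF.
rewrite -alternant_partition.
- by congr (\det _); apply/matrixP => l i; rewrite !mxE (shape_flawless hP cP cF).
- by case: TP => [[]].
- by rewrite size_map (leq_trans (tab_size_le TP)).
Qed.

End ColoringPolynomial.

(** * Regularity of the Vandermonde product *)

Section MonomialAlgebra.
Local Open Scope ring_scope.
Implicit Types (f : {malg {poly int}[{cmonom nat}]}) (m : {cmonom nat}).

Definition xvar (i : nat) : {malg {poly int}[{cmonom nat}]} := << ucm i >>.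

Lemma mul_ucmI i : injective (mmul (ucm i : {cmonom nat})).
Proof.
move=> m1 m2 /eqP/cmP E; apply/eqP/cmP => j.
by have := E j; rewrite !cmM => /addnI.
Qed.

Lemma xvarMU i a m : xvar i * << a *g m >> = << a *g mmul (ucm i) m >>.
Proof. by rewrite /xvar malgM_def fgmulUU mul1r. Qed.

Lemma mcoeff_xvarM i f m : (xvar i * f)@_(mmul (ucm i) m) = f@_m.
Proof.
rewrite {1}[f]monalgE mulr_sumr raddf_sum /= [in RHS](monalgE f) raddf_sum /=.
apply: eq_bigr => m' _.
by rewrite xvarMU !mcoeffU (inj_eq (@mul_ucmI i)).
Qed.

Lemma mcoeff_xvarM0 i f m : m i = 0%N -> (xvar i * f)@_m = 0.
Proof.
move=> mi; rewrite {1}[f]monalgE mulr_sumr raddf_sum /= big1 // => m' _.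
rewrite xvarMU mcoeffU; case: eqP => // E; move: mi.
by rewrite -E cmM cmUU.
Qed.

(** Since [x_i f = x_j f], the coefficient of [f] at [m] equals the one at [x_i m / x_j], or
    vanishes if [x_j] does not divide [m]. Each step lowers the exponent of [x_j], whence the
    induction. *)
Lemma xvar_sub_reg i j f : i != j -> (xvar i - xvar j) * f = 0 -> f = 0.
Proof.
move=> ij /eqP; rewrite mulrBl subr_eq0 => /eqP E.
have cE m : f@_m = (xvar j * f)@_(mmul (ucm i) m) by rewrite -E mcoeff_xvarM.
have ucm_ij : (ucm i : {cmonom nat}) j = 0%N by rewrite cmU (negPf ij).
apply/malgP => m; rewrite mcoeff0; move: {2}(m j) (leqnn (m j)) => d.
elim: d m => [|d IH] m md; rewrite cE.
  by apply: mcoeff_xvarM0; rewrite cmM ucm_ij; apply/eqP; rewrite -leqn0.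
have [mj|mj] := eqVneq (m j) 0%N; first by rewrite -cE; apply: IH; rewrite mj.
pose m' : {cmonom nat} := divcm m (ucm j).
have mE : m = mmul (ucm j) m'.
  apply/eqP/cmP => l; rewrite cmM divcmE cmU; case: eqP => [<-|_]; last by rewrite add0n subn0.
  by apply/esym/subnKC; rewrite /= lt0n; exact: mj.
have -> : mmul (ucm i) m = mmul (ucm j) (mmul (ucm i) m').
  by apply/eqP/cmP => l; rewrite mE !cmM addnCA.
rewrite mcoeff_xvarM; apply: IH.
rewrite cmM ucm_ij divcmE cmUU add0n leq_subLR add1n; exact: md.
Qed.

Lemma vandermonde_reg k f : vandermonde xvar k * f = 0 -> f = 0.
Proof.
rewrite /vandermonde; elim/big_ind: _ f => [f|a b IHa IHb f|j _ f].
- by rewrite mul1r.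
- by rewrite -mulrA => /IHa/IHb.
elim/big_ind: _ f => [f|a b IHa IHb f|i _ f].
- by rewrite mul1r.
- by rewrite -mulrA => /IHa/IHb.
by apply: xvar_sub_reg; rewrite ltn_eqF.
Qed.

Lemma vandermonde_inj k : injective (GRing.mul (vandermonde xvar k)).
Proof.
move=> f g /eqP; rewrite -subr_eq0 -mulrBr => /eqP/vandermonde_reg/eqP.
by rewrite subr_eq0 => /eqP.
Qed.

Lemma mcoeff_bigsum (I : Type) (s : seq I) (Q : pred I)
    (F : I -> {malg {poly int}[{cmonom nat}]}) m :
  (\sum_(i <- s | Q i) F i)@_m = \sum_(i <- s | Q i) (F i)@_m.
Proof. exact: raddf_sum. Qed.

Lemma prod_xvar (I : Type) (s : seq I) (g : I -> nat) :
  \prod_(i <- s) xvar (g i) = << \big[mmul/mone]_(i <- s) ucm (g i) >>.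
Proof.
elim: s => [|i s IH]; first by rewrite !big_nil.
rewrite !big_cons IH; exact: xvarMU.
Qed.

Lemma malg_double0 f : f + f = 0 -> f = 0.
Proof.
move=> E; apply/malgP => m; rewrite mcoeff0.
have {}E : f@_m + f@_m = 0 by rewrite -mcoeffD E mcoeff0.
move: (f@_m : {poly int}) E => p E; apply/polyP => i.
have /eqP := congr1 (fun q : {poly int} => q`_i) E.
by rewrite coefD !coef0 -mulr2n Num.Theory.mulrn_eq0 /= => /eqP.
Qed.

End MonomialAlgebra.

Local Open Scope classical_set_scope.
Local Open Scope ring_scope.

Section Coefficients.
Variables (n : nat) (P : rel 'I_n) (m : {cmonom nat}) (k : nat).
Hypothesis mk : forall e, e \in finsupp m -> (e < k)%N.
Local Open Scope ring_scope.

(** Each colour used by a colouring of monomial [m] is the index of a variable of [m], so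
    restricting to [k] colours loses nothing. *)
Lemma chromatic_series_coef :
  chromatic_series (incomp P) m =
  \sum_(c : {ffun 'I_n -> 'I_k} | properb P c && (coloring_monom (nat_coloring c) == m))
    'X^(asc (incomp P) (nat_coloring c)).
Proof.
pose L := [seq nat_coloring c | c <- enum [pred c : {ffun 'I_n -> 'I_k} |
   properb P c && (coloring_monom (nat_coloring c) == m)]].
have LU : uniq L.
  rewrite map_inj_uniq ?enum_uniq // => c d /ffunP cd; apply/ffunP => v; apply: val_inj.
  by have := cd v; rewrite !ffunE.
rewrite /chromatic_series /genseries.
have -> : ([set c | proper_coloring (incomp P) c] `&` @coloring_monom n @^-1` [set m])%classic
   = [set` L]%classic.
  apply/seteqP; split=> c /=.
    move=> [cP cm].
    have ck v : (c v < k)%N.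
      apply: mk; have -> : m = \big[mmul/mone]_(e <- [seq c i | i <- enum 'I_n]) ucm e.
        by rewrite big_map -cm /coloring_monom big_enum.
      by rewrite -mem_prod_ucm map_f ?mem_enum.
    have cE : c = nat_coloring [ffun v => Ordinal (ck v)].
      by apply/ffunP => v; rewrite !ffunE.
    apply/mapP; exists [ffun v => Ordinal (ck v)] => //.
    rewrite mem_enum inE -cE cm eqxx andbT; apply/forallP => u; apply/forallP => v.
    by apply/implyP => /cP/eqP; rewrite !ffunE -val_eqE.
  case/mapP => d; rewrite mem_enum inE => /andP[dP /eqP dm] ->; split=> // u v uv.
  by rewrite !ffunE; apply/eqP; rewrite val_eqE (proper_neq dP uv).
by rewrite -fsbig_seq // big_map big_enum.
Qed.

Lemma schur_coef la : is_partition la -> (size la <= k)%N ->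
  schur la m = \sum_(T <- bounded_ssyts k la | tableau_monom T == m) 1.
Proof.
move=> laP lak; rewrite -big_filter /schur /genseries.
have -> : ([set T | ssyt T /\ shape T = la] `&` tableau_monom @^-1` [set m])%classic =
    [set` [seq T <- bounded_ssyts k la | tableau_monom T == m]]%classic.
  apply/seteqP; split=> T /=.
    case=> [[Ts TE] Tm]; rewrite mem_filter Tm eqxx /=; apply/mem_bounded_ssyts => //.
    by split=> //; apply/allP => e eT; apply: mk; rewrite -Tm -mem_prod_ucm.
  by rewrite mem_filter => /andP[/eqP Tm /mem_bounded_ssyts[]].
by rewrite -fsbig_seq //; apply: filter_uniq; exact: bounded_ssyts_uniq.
Qed.

End Coefficients.

Theorem theorem4p10 (n : nat) (P : rel 'I_n)
    (hP : natural_unit_interval_order P) :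
  chromatic_series (incomp P) =
  \sum_(T \in P_tableaux P) 'X^(tab_inv (incomp P) T) *: schur (shape T).
Proof.
apply/funext => m.
have [k nk mk] : exists2 k, (n <= k)%N & forall e, e \in finsupp m -> (e < k)%N.
  exists (n + \max_(e <- finsupp m) e.+1)%N; first exact: leq_addr.
  by move=> e em; apply: leq_trans (leq_addl _ _); exact: leq_bigmax_seq.
rewrite (chromatic_series_coef P mk) (sum_tableaux hP _ nk) fct_sumE /=.
have coefX (a : nat) f : (('X^a)%:MP * f : {malg {poly int}[{cmonom nat}]})@_m = 'X^a * f@_m.
  exact: mcoeffCM.
pose t : {malg {poly int}[{cmonom nat}]} := ('X)%:MP.
have tE a : t ^+ a = ('X^a)%:MP by rewrite [RHS]rmorphXn.
(* The Vandermonde factor is cancelled between polynomials; only then is the coefficient of [m]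
   extracted. *)
have /vandermonde_inj/(congr1 (mcoeff m)) := vandermonde_asc_poly hP nk t xvar malg_double0.
move=> E0; have E := etrans (esym (mcoeff_bigsum _ _ _ _)) (etrans E0 (mcoeff_bigsum _ _ _ _)).
transitivity (\sum_(c : {ffun 'I_n -> 'I_k} | properb P c)
   (t ^+ asc (incomp P) (nat_coloring c) * \prod_v xvar (c v))@_m).
  rewrite big_mkcondr; apply: eq_bigr => c _.
  rewrite tE coefX prod_xvar mcoeffU.
  have -> : \big[mmul/mone]_(v <- index_enum 'I_n) ucm (c v : nat) = coloring_monom (nat_coloring c).
    by apply: eq_bigr => v _; rewrite ffunE.
  by case: eqP; rewrite ?mulr1 ?mulr0.
rewrite E; apply: eq_bigr => c /andP[cP cF].
have TP := color_tableau_is_tableau hP cP cF.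
have laP : is_partition (shape (color_tableau c)) by case: TP => [[]].
have lak : (size (shape (color_tableau c)) <= k)%N.
  by rewrite size_map (leq_trans (tab_size_le TP)).
rewrite tE coefX (tab_inv_color_tableau hP cP cF) scalrfctE.
rewrite (schur_coef mk laP lak) mcoeff_bigsum [in RHS]big_mkcond; congr (_ * _).
by apply: eq_bigr => T _; rewrite prod_xvar mcoeffU; case: eqP.
Qed.
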